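(* Let $d\ge 2$ and let $K\subset\mathbb{R}^d$ be a convex body with center of gravity $\mathbf{cg}(K)$. Let $v\in\mathbb{R}^d$ with $\|v\|=1$, let $W=\{w:\langle v,w\rangle=0\}$, and define $K^+=K\cap\{w:\langle v,w\rangle\ge 0\}$ and $K^-=K\cap\{w:\langle v,w\rangle<0\}$, both assumed nonempty with $K\cap W$ of positive $(d-1)$-dimensional volume. Let $H_{K^+}=\max_{a\in K^+}\langle a,v\rangle$ and $H_{K^-}=\sup_{a\in K^-}\bigl(-\langle a,v\rangle\bigr)$ (the largest distance along $v$ from $W$ to a point of $K^-$). Let $R$ be the radius of the $(d-1)$-dimensional ball whose $(d-1)$-volume equals that of $K\cap W$, and let $\omega_{d-1}$ be the volume of the unit ball of $\mathbb{R}^{d-1}$. For $\lambda\in[0,1]$ set $$\Lambda=\lambda\,\frac{d\,\mathrm{V}(K)}{\omega_{d-1}R^{d-1}}\left[\frac{H_{K^+}}{(d+1)H_{K^-}}\right]^{d-1}\left(1-\frac{1}{d+1}\right).$$ If $\mathbf{cg}(K)+\Lambda v\in K^+$, then $$\frac{\mathrm{V}(K^+)}{\mathrm{V}(K)}\ \ge\ e^{-1}(1-\lambda)^{d}.$$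
   Context: $\mathrm{V}(\cdot)$ denotes $d$-dimensional Lebesgue volume. The center of gravity of a convex body $K$ is $\mathbf{cg}(K)=\int_K z\,dz\big/\int_K dz$. A convex body is a compact convex set with nonempty interior. *)

(* Defs.v *)
From HB Require Import structures.
From mathcomp Require Import all_boot all_order all_algebra.
From mathcomp Require Import all_classical all_reals all_analysis.
Set Implicit Arguments. Unset Strict Implicit. Unset Printing Implicit Defensive.
Import Order.TTheory GRing.Theory Num.Theory.
Import numFieldNormedType.Exports.
Local Open Scope classical_set_scope.
Local Open Scope ring_scope.

Definition dotv {R : realType} {n : nat} (u w : 'rV[R]_n) : R := (u *m w^T) 0 0.
Definition enorm {R : realType} {n : nat} (u : 'rV[R]_n) : R := Num.sqrt (dotv u u).

(* Iterated Lebesgue integral over R^n (Fubini/Tonelli style):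
   integral over R^0 is evaluation at the unique point, and
   int_{R^(m+1)} f = int_R ( int_{R^m} f(x, t) dt ) dx. *)
Fixpoint iint {R : realType} (n : nat) : ('rV[R]_n -> \bar R) -> \bar R :=
  match n with
  | 0 => fun f => f 0
  | m.+1 => fun f =>
      (\int[@lebesgue_measure R]_(x in [set: R])
          iint (fun t : 'rV[R]_m => f (row_mx (x%:M : 'rV[R]_1) t)))%E
  end.

Definition vol {R : realType} {n : nat} (A : set 'rV[R]_n) : R :=
  fine (iint (fun z => (\1_A z)%:E)).

Definition cg {R : realType} {n : nat} (K : set 'rV[R]_n) : 'rV[R]_n :=
  \row_(i < n) (fine (iint (fun z : 'rV[R]_n => (z 0 i * \1_K z)%:E)) / vol K).

Definition convex_body {R : realType} {n : nat} (K : set 'rV[R]_n) : Prop :=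
  [/\ compact K,
      (forall a b (t : R), K a -> K b -> 0 <= t <= 1 -> K ((1 - t) *: a + t *: b))
    & (K°) !=set0 ].

(* Embedding of R^(d-1) into R^d as the hyperplane {x_0 = 0}:
   y |-> (0, y_0, ..., y_(d-2)). *)
Definition hyp_embed {R : realType} (d : nat) (y : 'rV[R]_(d.-1)) : 'rV[R]_d :=
  \row_(i < d) (if (i : nat) == 0%N then 0
                else nth 0 [seq y 0 j | j <- enum 'I_(d.-1)] (i.-1)).

Definition orthogonal_mx {R : realType} {d : nat} (Q : 'M[R]_d) : Prop :=
  Q *m Q^T = 1%:M.

(* (d-1)-dimensional volume of the section K ∩ v^⊥, computed through an
   orthogonal matrix Q whose row 0 is v: the map y |-> (0,y) *m Q is a linear
   isometry of R^(d-1) onto v^⊥ (this quantity does not depend on Q). *)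
Definition section_area {R : realType} {d : nat} (Q : 'M[R]_d)
    (K : set 'rV[R]_d) : R :=
  vol [set y : 'rV[R]_(d.-1) | K (hyp_embed y *m Q)].

(* Main.v *)
Require Import Defs.
From HB Require Import structures.
From mathcomp Require Import all_boot all_order all_algebra.
From mathcomp Require Import all_classical all_reals all_analysis.
From mathcomp Require Import measurable_realfun ring lra.
Set Implicit Arguments. Unset Strict Implicit. Unset Printing Implicit Defensive.
Import Order.TTheory GRing.Theory Num.Theory.
Import numFieldNormedType.Exports.
Local Open Scope classical_set_scope.
Local Open Scope ring_scope.

(** Rotate so that [v] is the first basis vector and let [f t] be the volume of
    the slice of [K] at height [t].  By the Brunn-Minkowski inequality
    [f ^ (1/(d-1))] is concave.  Compare [f] with the profile [g] of the cone with
    the same volumes on both sides of [W] and the same section at height [0]: its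
    apex is at height [h = d V(K+) / f 0] and its total height [L] satisfies
    [V(K+) / V(K) = (h / L) ^ d].  Concavity forces [f - g] to change sign only
    once on each side of [0], so the cone has the higher center of gravity, which
    sits at [h - L d / (d+1)].  Concavity also gives [H_{K+} <= h] and
    [L - h <= H_{K-}]; if the center of gravity of the cone is negative, these
    bounds yield [Lambda <= lambda L d / (d+1)], hence
    [h / L >= (1 - lambda) d / (d+1)], and [(d / (d+1)) ^ d >= 1/e]. *)

(** * Affine changes of variable and iterated integrals *)

(** The constant in $\Lambda$ is calibrated on the cone. There $d\,V(K)/f(0)=L^d/h^{d-1}$, which
    collapses to $L$ once multiplied by $(h/L)^{d-1}$; so the bracket $H_{K^+}/((d+1)H_{K^-})$ must
    be at most $h/L$. Given $H_{K^+}\le h$ this asks for $L\le(d+1)H_{K^-}$, and a cone whose center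
    lies below $W$ provides it: $h<Ld/(d+1)$ gives $L/(d+1)<L-h\le H_{K^-}$. If the center of the
    cone is not below $W$, then $h/L\ge d/(d+1)$ already.

    Two obstacles shape the proof. Volume is an iterated integral in fixed coordinates, so its
    invariance under rotation is established by elimination into shears and triangular blocks. And
    slices may be empty or null, so the concavity of $f^{1/(d-1)}$ is expressed through positive
    lower bounds $a^{d-1}\le f(x)$: no root of zero occurs and nothing is claimed off the
    support. *)

Section affine.
Context {R : realType}.
Local Notation mu := (@lebesgue_measure R).

Let maffine (a b : R) :
  measurable_fun setT (fun x : measurableTypeR R => a * x + b : measurableTypeR R).
Proof. by apply: measurable_funD => //; exact: measurable_funM. Qed.

(** Bundles the pushforward as a measure together with an equation for its set function, so that it
    can be passed to measure-level lemmas and still be unfolded. *)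
Let affine_pushforward (a b : R) :
  {pm : {measure set (measurableTypeR R) -> \bar R} |
    pm = pushforward mu (fun x : measurableTypeR R => a * x + b : measurableTypeR R)
      :> (set _ -> \bar R)}.
Proof.
by exists (measure_function_pushforward__canonical__measure_function_Measure mu (maffine a b)).
Qed.

(** By uniqueness of Lebesgue measure: the pushforward scaled by [a] has the right value on bounded
    half-open intervals. *)
Lemma lebesgue_measure_affine (a b : R) (A : set R) : 0 < a -> measurable A ->
  (mu A = a%:E * mu ((fun x => a * x + b)%R @^-1` A))%E.
Proof.
move=> a0 mA; have a0' : 0 <= a by exact: ltW.
have [pm pmE] := affine_pushforward a b.
rewrite (_ : mu ((fun x => a * x + b)%R @^-1` A) = pm A); last by rewrite pmE.
rewrite -[RHS]/(mscale (NngNum a0') pm A).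
apply: lebesgue_measure_unique => // _ [[c d] _ <-].
rewrite -[RHS]/(a%:E * pm `]c, d]%classic)%E pmE /pushforward/=.
have -> : (fun x => a * x + b) @^-1` `]c, d] = `](c - b) / a, (d - b) / a]%classic.
  apply/seteqP; split => x /=; rewrite !in_itv/= ltr_pdivrMr// ler_pdivlMr//;
  by rewrite ltrBlDr lerBrDr (mulrC x).
rewrite !lebesgue_measure_itv/= !lte_fin ltr_pdivrMr// divfK ?gt_eqF//.
rewrite ltrD2r; case: ifP => _; rewrite ?mule0//.
by rewrite -!EFinD -EFinM; congr EFin; field; rewrite gt_eqF.
Qed.

Lemma ge0_integral_affine_pos (a b : R) (f : R -> \bar R) : 0 < a ->
  measurable_fun setT f -> (forall x, 0 <= f x)%E ->
  (\int[mu]_x f x = a%:E * \int[mu]_x f (a * x + b)%R)%E.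
Proof.
move=> a0 mf f0; have a0' : 0 <= a by exact: ltW.
have [pm pmE] := affine_pushforward a b.
have -> : (\int[mu]_x f (a * x + b)%R = \int[pm]_x f x)%E.
  by rewrite pmE (ge0_integral_pushforward (maffine a b)).
rewrite -(@ge0_integral_mscale _ _ _ pm setT measurableT (NngNum a0') f)//=.
apply: eq_measure_integral => A mA _.
rewrite -[RHS]/(a%:E * pm A)%E pmE; exact: lebesgue_measure_affine.
Qed.

Lemma ge0_integralN (f : R -> \bar R) :
  measurable_fun setT f -> (forall x, 0 <= f x)%E ->
  (\int[mu]_x f x = \int[mu]_x f (- x)%R)%E.
Proof.
move=> mf f0; rewrite [RHS](_ : _ =
  \int[pushforward mu (-%R : measurableTypeR R -> measurableTypeR R)]_x f x)%E.
  by apply: eq_measure_integral => A mA _; rewrite -[LHS]lebesgue_measureN.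
by rewrite ge0_integral_pushforward.
Qed.

Lemma ge0_integral_affine (a b : R) (f : R -> \bar R) : a != 0 ->
  measurable_fun setT f -> (forall x, 0 <= f x)%E ->
  (\int[mu]_x f x = `|a|%:E * \int[mu]_x f (a * x + b)%R)%E.
Proof.
move=> a0 mf f0; case: (ltgtP a 0) a0 => // [an|ap] _; last first.
  by rewrite gtr0_norm//; exact: ge0_integral_affine_pos.
rewrite ltr0_norm// ge0_integralN// (@ge0_integral_affine_pos (- a) (- b)) ?oppr_gt0//.
  by under [in RHS]eq_integral do rewrite -[X in f X]opprK opprD -mulNr.
exact: measurableT_comp.
Qed.

Lemma ge0_integral_translate (b : R) (f : R -> \bar R) :
  measurable_fun setT f -> (forall x, 0 <= f x)%E ->
  (\int[mu]_x f (x + b)%R = \int[mu]_x f x)%E.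
Proof.
move=> mf f0; rewrite (@ge0_integral_affine 1 b f) ?oner_eq0// normr1 mul1e.
by under [RHS]eq_integral do rewrite mul1r.
Qed.

End affine.

(* Measurability on ['rV_n] is tested against all coordinatewise measurable maps
   into ['rV_n], so that no sigma-algebra on matrices is needed. *)
Definition pmeas {R : realType} {dU} {U : measurableType dU} {n : nat}
    (f : U -> 'rV[R]_n -> \bar R) :=
  forall d (T : measurableType d) (u : T -> U) (g : T -> 'rV[R]_n),
    measurable_fun setT u ->
    (forall i, measurable_fun setT (fun t => g t 0 i : measurableTypeR R)) ->
    measurable_fun setT (fun t => f (u t) (g t)).

Definition rvmeas {R : realType} {n : nat} (f : 'rV[R]_n -> \bar R) :=
  forall d (T : measurableType d) (g : T -> 'rV[R]_n),
    (forall i, measurable_fun setT (fun t => g t 0 i : measurableTypeR R)) ->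
    measurable_fun setT (fun t => f (g t)).

Section iterated.
Context {R : realType}.
Local Notation mu := (@lebesgue_measure R).
Local Notation RT := (measurableTypeR R).

Lemma iint_ge0 n (f : 'rV[R]_n -> \bar R) : (forall z, 0 <= f z)%E -> (0 <= iint f)%E.
Proof.
elim: n f => [|n IH] f f0 /=; first exact: f0.
by apply: integral_ge0 => x _; apply: IH => t.
Qed.

Lemma eq_iint n (f g : 'rV[R]_n -> \bar R) : f =1 g -> iint f = iint g.
Proof. by move=> /funext ->. Qed.

Lemma row_mx_meas d (T : measurableType d) n (x : T -> R) (g : T -> 'rV[R]_n) :
  measurable_fun setT (x : T -> RT) ->
  (forall i, measurable_fun setT (fun t => g t 0 i : RT)) ->
  forall i, measurable_fun setT (fun t => (row_mx (x t)%:M (g t) : 'rV[R]_n.+1) 0 i : RT).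
Proof.
move=> mx mg i; case: (@splitP 1 n i) => j ij.
  have -> : i = lshift n j by apply/val_inj.
  rewrite [X in measurable_fun _ X](_ : _ = x)//; apply/funext => t.
  by rewrite (@row_mxEl _ 1 1 n) ord1 mxE eqxx mulr1n.
have -> : i = rshift 1 j by apply/val_inj.
rewrite [X in measurable_fun _ X](_ : _ = fun t => g t 0 j)//; apply/funext => t.
by rewrite (@row_mxEr _ 1 1 n).
Qed.

(** The induction peels off one coordinate and absorbs it into the parameter, replacing [U] by
    [U * RT]; hence the arbitrary parameter space in [pmeas]. *)
Lemma measurable_iint n dU (U : measurableType dU) (f : U -> 'rV[R]_n -> \bar R) :
  pmeas f -> (forall u z, 0 <= f u z)%E ->
  measurable_fun setT (fun u => iint (f u)).
Proof.
elim: n dU U f => [|n IH] dU U f mf f0 /=.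
  by apply: mf => // i; exact: measurable_cst.
pose F (p : U * RT) := iint (fun t => f p.1 (row_mx (p.2%:M : 'rV[R]_1) t)).
have F0 p : (0 <= F p)%E by exact: iint_ge0.
have mF : measurable_fun setT F.
  apply: (IH _ _ (fun (p : U * RT) t => f p.1 (row_mx (p.2%:M : 'rV[R]_1) t))) => //.
  move=> d T u g mu' mg; apply: mf.
    exact: measurableT_comp measurable_fst mu'.
  by apply: row_mx_meas => //; exact: measurableT_comp measurable_snd mu'.
exact: (measurable_fun_fubini_tonelli_F F mF F0).
Qed.

Lemma rvmeas_slice n (f : 'rV[R]_n.+1 -> \bar R) : rvmeas f ->
  pmeas (fun (x : RT) (t : 'rV[R]_n) => f (row_mx (x%:M : 'rV[R]_1) t)).
Proof. by move=> mf d T u g mu' mg; apply: mf; exact: row_mx_meas. Qed.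

Lemma pmeas_rvmeas n dU (U : measurableType dU) (f : U -> 'rV[R]_n -> \bar R) u :
  pmeas f -> rvmeas (f u).
Proof. by move=> mf d T g mg; apply: mf => //; exact: measurable_cst. Qed.

Lemma rvmeas_slice1 n (f : 'rV[R]_n.+1 -> \bar R) (x : R) : rvmeas f ->
  rvmeas (fun t : 'rV[R]_n => f (row_mx (x%:M : 'rV[R]_1) t)).
Proof. by move=> mf; exact: (pmeas_rvmeas _ (rvmeas_slice mf)). Qed.

Lemma measurable_iint_slice n (f : 'rV[R]_n.+1 -> \bar R) : rvmeas f ->
  (forall z, 0 <= f z)%E ->
  measurable_fun setT (fun x : RT => iint (fun t => f (row_mx (x%:M : 'rV[R]_1) t))).
Proof. by move=> mf f0; apply: measurable_iint => //; exact: rvmeas_slice. Qed.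

(** Tonelli exchanges the outer variable with the first coordinate; the induction carries it past
    the others. *)
Lemma iint_swap n (F : RT -> 'rV[R]_n -> \bar R) : pmeas F ->
  (forall x z, 0 <= F x z)%E ->
  (\int[mu]_x iint (F x) = iint (fun t => \int[mu]_x F x t))%E.
Proof.
elim: n F => [//|n IH] F mF F0 /=.
pose G (p : RT * RT) := iint (fun t => F p.1 (row_mx (p.2%:M : 'rV[R]_1) t)).
have mG : measurable_fun setT G.
  apply: (@measurable_iint _ _ _
    (fun (p : RT * RT) t => F p.1 (row_mx (p.2%:M : 'rV[R]_1) t))) => //.
  move=> d T u g mu' mg; apply: mF; first exact: measurableT_comp measurable_fst mu'.
  by apply: row_mx_meas => //; exact: measurableT_comp measurable_snd mu'.
have G0 p : (0 <= G p)%E by exact: iint_ge0.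
transitivity (\int[mu]_x \int[mu]_y G (x, y))%E; first by [].
rewrite (@fubini_tonelli _ _ _ _ _ mu mu G mG G0); apply: eq_integral => y _.
rewrite /G/= IH// => d T u g mu' mg.
by apply: mF => //; apply: row_mx_meas => //; exact: measurable_cst.
Qed.

Lemma row_mx_split n (b : 'rV[R]_n.+1) :
  b = row_mx ((b 0 0)%:M : 'rV[R]_1) (@rsubmx R 1 1 n b).
Proof.
apply/rowP => i; case: (@splitP 1 n i) => j ij.
  have -> : i = lshift n j by apply/val_inj.
  rewrite (@row_mxEl _ 1 1 n) ord1 mxE eqxx mulr1n; congr (b _ _); exact: val_inj.
have -> : i = rshift 1 j by apply/val_inj.
by rewrite (@row_mxEr _ 1 1 n) mxE.
Qed.

Lemma row_mx_addl n (x : R) (t : 'rV[R]_n) (b : 'rV[R]_n.+1) :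
  (row_mx (x%:M : 'rV[R]_1) t : 'rV[R]_n.+1) + b =
  row_mx ((x + b 0 0)%:M : 'rV[R]_1) (t + @rsubmx R 1 1 n b).
Proof.
rewrite {1}(row_mx_split b) raddfD.
exact: (@add_row_mx R 1 1 n x%:M t (b 0 0)%:M (@rsubmx R 1 1 n b)).
Qed.

Lemma iint_translate n (f : 'rV[R]_n -> \bar R) (b : 'rV[R]_n) : rvmeas f ->
  (forall z, 0 <= f z)%E -> iint (fun z => f (z + b)) = iint f.
Proof.
elim: n f b => [|n IH] f b mf f0 /=.
  by congr f; apply/rowP => -[].
under eq_integral => x _.
  under eq_iint => t do rewrite row_mx_addl.
  rewrite (IH (fun t => f (row_mx (x + b 0 0)%:M t)))//; last exact: rvmeas_slice1.
  over.
rewrite (@ge0_integral_translate R (b 0 0)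
  (fun x => iint (fun t => f (row_mx (x%:M : 'rV[R]_1) t))))//.
- exact: measurable_iint_slice.
- by move=> x; exact: iint_ge0.
Qed.

Lemma mulmx_meas d (T : measurableType d) n k (g : T -> 'rV[R]_n) (A : 'M[R]_(n, k)) :
  (forall i, measurable_fun setT (fun t => g t 0 i : RT)) ->
  forall i, measurable_fun setT (fun t => (g t *m A) 0 i : RT).
Proof.
move=> mg i; under eq_fun do rewrite mxE.
apply: (@measurable_sum _ _ R setT _ _ (fun j t => g t 0 j * A j i)) => j.
apply: measurable_funM; [exact: mg|exact: measurable_cst].
Qed.

Lemma rvmeas_mulmx n k (f : 'rV[R]_k -> \bar R) (A : 'M[R]_(n, k)) : rvmeas f ->
  rvmeas (fun z => f (z *m A)).
Proof. by move=> mf d T g mg; apply: mf; exact: mulmx_meas. Qed.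

Lemma iintZl n (c : R) (f : 'rV[R]_n -> \bar R) : 0 <= c -> rvmeas f ->
  (forall z, 0 <= f z)%E -> (iint (fun z => c%:E * f z) = c%:E * iint f)%E.
Proof.
move=> c0; elim: n f => [//|n IH] f mf f0 /=.
under eq_integral => x _.
  rewrite (IH (fun t => f (row_mx (x%:M : 'rV[R]_1) t)))//; last exact: rvmeas_slice1.
  over.
rewrite ge0_integralZl_EFin//.
- by move=> x _; exact: iint_ge0.
- exact: measurable_iint_slice.
Qed.

End iterated.

(** * Linear changes of variable *)

Section linear_change.
Context {R : realType}.
Local Notation mu := (@lebesgue_measure R).
Local Notation RT := (measurableTypeR R).

(** The change of variables formula as a property of the matrix: it is closed under products, so
    only elementary factors have to be checked. *)
Definition scales_iint n (A : 'M[R]_n) := forall f : 'rV[R]_n -> \bar R,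
  rvmeas f -> (forall z, 0 <= f z)%E ->
  (`|\det A|%:E * iint (fun z => f (z *m A)) = iint f)%E.

Lemma scales_iint_mul n (A B : 'M[R]_n) :
  scales_iint A -> scales_iint B -> scales_iint (A *m B).
Proof.
move=> cA cB f mf f0; rewrite -(cB f)// -(cA (fun z => f (z *m B)))//; last exact: rvmeas_mulmx.
rewrite det_mulmx normrM mulrC EFinM muleA; congr (_ * _)%E.
by apply: eq_iint => z; rewrite mulmxA.
Qed.

(** For fixed [x] the inner integral absorbs the translation by [x *: b] and the block [S]; what
    remains outside is a one-dimensional scaling by [a]. *)
Lemma scales_iint_ublock n (a : R) (b : 'rV[R]_n) (S : 'M[R]_n) : a != 0 ->
  scales_iint S -> scales_iint (block_mx a%:M b 0 S : 'M[R]_(1 + n)).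
Proof.
move=> a0 cS f mf f0; rewrite det_ublock det_scalar1 normrM.
set A := block_mx _ _ _ _.
have zA (x : R) (t : 'rV[R]_n) : row_mx x%:M t *m A =
    row_mx (a * x + 0)%:M (t *m S + x *: b).
  rewrite mul_row_block mulmx0 addr0 addr0 -scalar_mxM mulrC.
  by rewrite mul_scalar_mx addrC.
have mfA : rvmeas (fun z : 'rV[R]_n.+1 => f (z *m A)) by exact: rvmeas_mulmx.
have := @measurable_iint_slice R n _ mfA (fun z => f0 _).
rewrite EFinM -muleA /= => mI.
rewrite -ge0_integralZl_EFin//=; last by move=> x _; exact: iint_ge0.
rewrite [RHS](@ge0_integral_affine _ a 0)//.
- congr (_ * _)%E; apply: eq_integral => x _.
  under eq_iint => t do rewrite zA.
  have mfx (y : R) : rvmeas (fun t => f (row_mx (y%:M : 'rV[R]_1) t)) by exact: rvmeas_slice1.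
  rewrite -(@iint_translate _ _ (fun t => f (row_mx ((a * x + 0)%:M : 'rV[R]_1) t)) (x *: b))//.
  rewrite -(cS (fun t => f (row_mx ((a * x + 0)%:M : 'rV[R]_1) (t + x *: b))))//.
  move=> d T g mg; apply: (mfx (a * x + 0) d T (fun t => g t + x *: b)) => i.
  under eq_fun do rewrite !mxE.
  by apply: measurable_funD => //; exact: mg.
- exact: measurable_iint_slice.
- by move=> x; exact: iint_ge0.
Qed.

(** The first coordinate moves by an amount depending on the others, so its integral is brought
    innermost, where for fixed [t] it is a translation. *)
Lemma scales_iint_lshear n (c : 'cV[R]_n) :
  scales_iint (block_mx 1%:M 0 c 1%:M : 'M[R]_(1 + n)).
Proof.
move=> f mf f0; rewrite det_lblock !det1 mulr1 normr1 mul1e.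
set A := block_mx _ _ _ _.
have zA (x : R) (t : 'rV[R]_n) : row_mx x%:M t *m A =
    row_mx (x + (t *m c) 0 0)%:M t.
  rewrite mul_row_block !mulmx1 mulmx0 add0r raddfD/=; congr (row_mx (_ + _) _).
  exact: mx11_scalar.
have mfA : rvmeas (fun z : 'rV[R]_n.+1 => f (z *m A)) by exact: rvmeas_mulmx.
rewrite /= iint_swap//; last exact: (rvmeas_slice mfA).
rewrite iint_swap//; last exact: rvmeas_slice.
apply: eq_iint => t.
under eq_integral => x _ do rewrite zA.
rewrite (@ge0_integral_translate _ _ (fun x => f (row_mx (x%:M : 'rV[R]_1) t)))//.
apply: (mf _ RT (fun x => row_mx (x%:M : 'rV[R]_1) t)).
by apply: (@row_mx_meas _ _ _ n) => // i; exact: measurable_cst.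
Qed.

(** Gaussian elimination without row exchanges: one shear creates a nonzero pivot [a], another
    clears the column below it, and the induction runs on the Schur complement [S]. *)
Theorem iint_mulmx n (A : 'M[R]_n) : \det A != 0 -> scales_iint A.
Proof.
have c1 k : scales_iint (1%:M : 'M[R]_k).
  move=> f mf f0; rewrite det1 normr1 mul1e; apply: eq_iint => z.
  by rewrite mulmx1.
elim: n A => [|n IH] A dA.
  by rewrite (_ : A = 1%:M)//; apply/matrixP => -[].
pose B : 'M[R]_(1 + n) := A.
(* If the corner is zero and no combination of the lower rows helps, the first column vanishes, and
   so does the determinant. *)
have [u du] : exists u : 'rV[R]_n, ulsubmx B 0 0 + (u *m dlsubmx B) 0 0 != 0.
  have [a0|a0] := eqVneq (ulsubmx B 0 0) 0; last by exists 0; rewrite mul0mx [X in _ + X]mxE addr0.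
  apply: contrapT => /forallNP dl0; move/negP: dA; apply.
  rewrite (_ : \det A = \det B)// -(submxK B).
  have -> : dlsubmx B = 0.
    apply/colP => i; rewrite [RHS]mxE.
    have /negP/negPn/eqP := dl0 (delta_mx 0 i).
    by rewrite a0 add0r -rowE mxE.
  have -> : ulsubmx B = 0 by rewrite (mx11_scalar (ulsubmx B)) a0 raddf0.
  by rewrite det_ublock det_mx11 mxE mul0r.
pose a := ulsubmx B 0 0 + (u *m dlsubmx B) 0 0.
pose b := ursubmx B + u *m drsubmx B.
pose c := dlsubmx B.
pose S := drsubmx B - a^-1 *: (c *m b).
have BE : B = block_mx 1%:M (- u) 0 1%:M *m
    (block_mx 1%:M 0 (a^-1 *: c) 1%:M *m block_mx a%:M b 0 S).
  have aE : a%:M = ulsubmx B + u *m dlsubmx B.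
    by rewrite /a raddfD/= -!mx11_scalar.
  rewrite [block_mx _ _ (a^-1 *: c) _ *m _]mulmx_block !mul1mx !mul0mx !addr0.
  rewrite -!scalemxAl mul_mx_scalar scalerA mulVf// scale1r subrKC.
  rewrite mulmx_block !mul1mx !mul0mx !add0r aE !mulNmx !addrK.
  by rewrite submxK.
change (scales_iint B); rewrite BE; apply: scales_iint_mul.
  have := @scales_iint_ublock n 1 (- u) 1%:M (oner_neq0 _) (c1 n); exact.
apply: scales_iint_mul; first exact: scales_iint_lshear.
apply: scales_iint_ublock => //; apply: IH.
apply: contraNneq dA => S0; rewrite (_ : \det A = \det B)// BE !det_mulmx !det_ublock S0.
by rewrite !mulr0.
Qed.

End linear_change.

(** * Measurability of open and closed sets, and cubes containing compact sets *)

Section closed_measurable.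
Context {R : realType}.
Local Notation RT := (measurableTypeR R).

Definition rvmset n (A : set 'rV[R]_n) := rvmeas (fun z => (\1_A z)%:E : \bar R).

Lemma rvmsetP n (A : set 'rV[R]_n) : rvmset A <->
  forall d (T : measurableType d) (g : T -> 'rV[R]_n),
    (forall i, measurable_fun setT (fun t => g t 0 i : RT)) ->
    measurable (g @^-1` A).
Proof.
split=> mA d T g mg.
  apply/(@measurable_indicP _ _ R); apply/measurable_EFinP.
  by have := mA d T g mg.
by apply/measurable_EFinP; exact/(@measurable_indicP _ _ R)/(mA _ _ g).
Qed.

(** An open set is a countable union of cubes with rational centers and radii, and membership in
    such a cube is a finite conjunction of conditions on coordinates. *)
Lemma open_rvmset n (A : set 'rV[R]_n) : open A -> rvmset A.
Proof.
move=> oA; apply/rvmsetP => d T g mg.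
pose Bq (p : 'rV[rat]_n * rat) : set 'rV[R]_n :=
  [set z | forall i, `|ratr (p.1 0 i) - z 0 i| < ratr p.2].
have AE : A = \bigcup_(p in [set p | Bq p `<=` A]) Bq p.
  apply/seteqP; split => [z Az|z [p /= pA /pA//]].
  have /nbhs_ballP[e /= e0 eA] : nbhs z A by apply: open_nbhs_nbhs.
  (* The center will be within [r] of [z] and of every point of the cube, which therefore stays
     within [2 * r < e] of [z]. *)
  have [r] := @rat_in_itvoo R 0 (e / 2) ltac:(lra).
  rewrite in_itv/= => /andP[r0 re].
  have qx (i : 'I_n) : exists q : rat, `|ratr q - z 0 i| < ratr r.
    have [q] := @rat_in_itvoo R (z 0 i - ratr r) (z 0 i + ratr r) ltac:(lra).
    by rewrite in_itv/= => /andP[? ?]; exists q; rewrite ltr_norml; lra.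
  pose q := \row_i xchoose (qx i).
  have qz : Bq (q, r) z by move=> i; rewrite /= /q mxE; exact: (xchooseP (qx i)).
  exists (q, r) => //= y qy; apply: eA; split=> // i j; rewrite ord1 /ball/=.
  have := qz j; have := qy j; rewrite /=.
  by rewrite !ltr_norml; lra.
rewrite AE preimage_bigcup.
rewrite bigcup_mkcond; apply: countable_bigcupT_measurable => // p.
case: ifP => // _; rewrite (_ : _ @^-1` _ = \bigcap_(i in [set: 'I_n])
    [set t | `|ratr (p.1 0 i) - g t 0 i| < ratr p.2]); last first.
  by apply/seteqP; split => t /= h i; [move=> _; exact: h|exact: (h i I)].
apply: fin_bigcap_measurable => // i _.
rewrite (_ : [set _ | _] = (fun t => g t 0 i : RT) @^-1` ball (ratr (p.1 0 i) : R) (ratr p.2 : R)).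
  by rewrite -[X in measurable X]setTI; apply: mg => //; exact: measurable_ball.
by [].
Qed.

Lemma rvmsetC n (A : set 'rV[R]_n) : rvmset A -> rvmset (~` A).
Proof.
move=> /rvmsetP mA; apply/rvmsetP => d T g mg.
by rewrite preimage_setC; apply: measurableC; exact: mA.
Qed.

Lemma rvmsetI n (A B : set 'rV[R]_n) : rvmset A -> rvmset B -> rvmset (A `&` B).
Proof.
move=> /rvmsetP mA /rvmsetP mB; apply/rvmsetP => d T g mg.
by rewrite preimage_setI; apply: measurableI; [exact: mA|exact: mB].
Qed.

Lemma closed_rvmset n (A : set 'rV[R]_n) : closed A -> rvmset A.
Proof.
by move=> cA; rewrite -(setCK A); apply: rvmsetC; apply: open_rvmset; exact: closed_openC.
Qed.

Definition box n (M : R) : set 'rV[R]_n := [set z | forall i, `|z 0 i| <= M].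

Lemma compact_box n (A : set 'rV[R]_n) : compact A -> exists2 M, 0 < M & A `<=` box M.
Proof.
move=> /compact_bounded[M [_ MA]].
exists (`|M| + 1); first by rewrite ltr_wpDl.
move=> z Az i; have := MA (`|M| + 1) _ z Az.
move=> /(_ ltac:(by rewrite (le_lt_trans (ler_norm M))// ltrDl)) zM.
apply: le_trans zM.
rewrite [leRHS]/Num.norm/= mx_normrE.
exact: (@le_bigmax _ _ _ 0 (fun ij : 'I_1 * 'I_n => `|z ij.1 ij.2|) (0, i)).
Qed.

End closed_measurable.

(** * Domination on a cube, finiteness and additivity of iterated integrals *)

Section boxed.
Context {R : realType}.
Local Notation mu := (@lebesgue_measure R).
Local Notation RT := (measurableTypeR R).

(** A bound by a constant on a cube passes to slices with the same [M], so finiteness and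
    integrability follow by induction on the dimension. *)
Definition boxed n (C M : R) (f : 'rV[R]_n -> \bar R) :=
  forall z, (0 <= f z)%E /\ (f z <= (C * \1_(box M) z)%:E)%E.

Lemma boxed_slice n (C M : R) (f : 'rV[R]_n.+1 -> \bar R) (x : R) : boxed C M f ->
  boxed (C * \1_(`[- M, M]%classic) x) M (fun t => f (row_mx (x%:M : 'rV[R]_1) t)).
Proof.
move=> bf t; have [f0 fC] := bf (row_mx (x%:M : 'rV[R]_1) t); split => //.
apply: le_trans fC _; rewrite lee_fin -mulrA.
suff -> : \1_(box M) (row_mx (x%:M : 'rV[R]_1) t : 'rV[R]_n.+1) =
  \1_(`[- M, M]%classic) x * \1_(box M) t :> R by [].
rewrite !indicE -natrM mulnb; congr (nat_of_bool _)%:R.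
apply/idP/andP => [/set_mem h|[/set_mem h1 /set_mem h2]].
  split; apply/mem_set.
    have := h (@lshift 1 n 0); rewrite (@row_mxEl _ 1 1 n) mxE eqxx mulr1n.
    by rewrite /= in_itv/= ler_norml.
  by move=> i; have := h (rshift 1 i); rewrite (@row_mxEr _ 1 1 n).
apply/mem_set => i; case: (@splitP 1 n i) => j ij.
  have -> : i = lshift n j by apply/val_inj.
  rewrite (@row_mxEl _ 1 1 n) ord1 mxE eqxx mulr1n.
  by move: h1; rewrite /= in_itv/= ler_norml.
have -> : i = rshift 1 j by apply/val_inj.
by rewrite (@row_mxEr _ 1 1 n).
Qed.

Lemma le_iint n (f g : 'rV[R]_n -> \bar R) : rvmeas f -> rvmeas g ->
  (forall z, 0 <= f z)%E -> (forall z, f z <= g z)%E -> (iint f <= iint g)%E.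
Proof.
elim: n f g => [|n IH] f g mf mg f0 fg /=; first exact: fg.
have g0 z : (0 <= g z)%E by exact: le_trans (fg z).
apply: ge0_le_integral => //.
- by move=> x _; exact: iint_ge0.
- exact: measurable_iint_slice.
- exact: measurable_iint_slice.
- by move=> x _; apply: IH => //; exact: rvmeas_slice1.
Qed.

Lemma iint_boxed n (C M : R) (f : 'rV[R]_n -> \bar R) : 0 <= C -> 0 <= M ->
  rvmeas f -> boxed C M f -> (iint f <= (C * (2 * M) ^+ n)%:E)%E.
Proof.
move=> + M0; elim: n C f => [|n IH] C f C0 mf bf /=.
  rewrite expr0 mulr1; apply: le_trans (bf 0).2 _; rewrite lee_fin.
  by rewrite ler_piMr// indicE; case: (_ \in _).
have f0 z : (0 <= f z)%E by have [] := bf z.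
apply: (@le_trans _ _ (\int[mu]_x ((C * (2 * M) ^+ n)%:E * (\1_(`[- M, M]%classic) x)%:E))%E).
  apply: ge0_le_integral => //.
  - by move=> x _; exact: iint_ge0.
  - exact: measurable_iint_slice.
  - apply/measurable_EFinP; apply: measurable_funM => //.
  - move=> x _; rewrite -EFinM.
    have -> : C * (2 * M) ^+ n * \1_(`[- M, M]%classic) x =
       (C * \1_(`[- M, M]%classic) x) * (2 * M) ^+ n :> R by rewrite mulrAC.
    apply: IH.
    + by rewrite mulr_ge0.
    + exact: rvmeas_slice1.
    + exact: boxed_slice.
have cn : 0 <= C * (2 * M) ^+ n by rewrite mulr_ge0// exprn_ge0// mulr_ge0.
rewrite ge0_integralZl_EFin//; last by apply/measurable_EFinP.
rewrite integral_indic//= setIT lebesgue_measure_itv/= lte_fin.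
case: ifP => _; last by rewrite mule0 lee_fin mulr_ge0// exprn_ge0// mulr_ge0.
by rewrite -EFinD -EFinM lee_fin exprSr; nra.
Qed.

Lemma boxed_slice_le n (C M : R) (f : 'rV[R]_n.+1 -> \bar R) (x : R) : 0 <= C -> boxed C M f ->
  boxed C M (fun t => f (row_mx (x%:M : 'rV[R]_1) t)).
Proof.
move=> C0 bf t; have [f0 fC] := boxed_slice x bf t; split => //.
apply: le_trans fC _; rewrite lee_fin ler_wpM2r// ler_piMr// indicE.
Qed.

Lemma integrable_iint n (C M : R) (f : 'rV[R]_n.+1 -> \bar R) : 0 <= C -> 0 <= M ->
  rvmeas f -> boxed C M f ->
  mu.-integrable setT (fun x => iint (fun t => f (row_mx (x%:M : 'rV[R]_1) t))).
Proof.
move=> C0 M0 mf bf; have f0 z : (0 <= f z)%E by have [] := bf z.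
apply/integrableP; split; first exact: measurable_iint_slice.
under eq_integral => x _ do rewrite gee0_abs ?iint_ge0//.
exact: le_lt_trans (iint_boxed C0 M0 mf bf) (ltry _).
Qed.

Lemma iintB n (C M : R) (f g : 'rV[R]_n -> \bar R) : 0 <= C -> 0 <= M ->
  rvmeas f -> boxed C M f -> rvmeas g -> boxed C M g ->
  (iint (fun z => f z - g z) = iint f - iint g)%E.
Proof.
move=> C0 M0; elim: n f g => [//|n IH] f g mf bf mg bg /=.
under eq_integral => x _.
  rewrite (IH (fun t => f (row_mx (x%:M : 'rV[R]_1) t))
              (fun t => g (row_mx (x%:M : 'rV[R]_1) t))); last 4 first.
  - exact: rvmeas_slice1.
  - exact: boxed_slice_le.
  - exact: rvmeas_slice1.
  - exact: boxed_slice_le.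
  over.
by rewrite integralB//; apply: (integrable_iint C0 M0).
Qed.

Lemma iintD n (f g : 'rV[R]_n -> \bar R) : rvmeas f -> rvmeas g ->
  (forall z, 0 <= f z)%E -> (forall z, 0 <= g z)%E ->
  (iint (fun z => f z + g z) = iint f + iint g)%E.
Proof.
elim: n f g => [//|n IH] f g mf mg f0 g0 /=.
under eq_integral => x _.
  rewrite (IH (fun t => f (row_mx (x%:M : 'rV[R]_1) t))
              (fun t => g (row_mx (x%:M : 'rV[R]_1) t)))//; last 2 first.
  - exact: rvmeas_slice1.
  - exact: rvmeas_slice1.
  over.
rewrite ge0_integralD//; do ?by move=> x _; exact: iint_ge0.
- exact: measurable_iint_slice.
- exact: measurable_iint_slice.
Qed.

End boxed.

(** * The Brunn-Minkowski inequality *)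

Section powers.
Context {R : realType}.

Lemma exists_root (k : nat) (x : R) : 0 < x -> exists2 a : R, 0 < a & a ^+ k.+1 = x.
Proof.
move=> x0; exists (x `^ k.+1%:R^-1); first exact: powR_gt0.
by rewrite -powR_mulrn ?powR_ge0// -powRrM mulVf ?pnatr_eq0// powRr1// ltW.
Qed.

Lemma exprn_convex (k : nat) (p q r t : R) : 0 <= p -> 0 <= q -> p + q = 1 ->
  0 <= r -> 0 <= t -> (p * r + q * t) ^+ k <= p * r ^+ k + q * t ^+ k.
Proof.
move=> p0 q0 pq r0 t0; elim: k => [|k IH]; first by rewrite !expr0 !mulr1 pq.
rewrite exprS; apply: (@le_trans _ _ ((p * r + q * t) * (p * r ^+ k + q * t ^+ k))).
  by rewrite ler_wpM2l// addr_ge0// mulr_ge0.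
(* Chebyshev's argument: both factors have the same sign, and the gap in the induction step is
   [p * q] times this product. *)
have rt : 0 <= (r - t) * (r ^+ k - t ^+ k).
  have [h|h] := leP t r.
    by rewrite mulr_ge0 ?subr_ge0// lerXn2r.
  by rewrite mulr_le0 ?subr_le0 ?lerXn2r ?ltW.
rewrite !exprS -subr_ge0.
have -> : q = 1 - p by lra.
set rk := r ^+ k in rt *; set tk := t ^+ k in rt *.
have -> : p * (r * rk) + (1 - p) * (t * tk) - (p * r + (1 - p) * t) * (p * rk + (1 - p) * tk)
  = p * (1 - p) * ((r - t) * (rk - tk)) by ring.
by rewrite mulr_ge0// mulr_ge0//; lra.
Qed.

(** Convexity of the power [k.+1] at the points [x / a] and [y / b], with weights [(1 - s) * a / N]
    and [s * b / N]. This is a discrete Hölder inequality; it recombines sets whose largest slices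
    have different sizes. *)
Lemma weighted_power_mean (k : nat) (s a b x y : R) : 0 < s < 1 -> 0 < a -> 0 < b ->
  0 <= x -> 0 <= y ->
  ((1 - s) * x + s * y) ^+ k.+1 <=
  ((1 - s) * a + s * b) ^+ k * ((1 - s) * (x ^+ k.+1 / a ^+ k) + s * (y ^+ k.+1 / b ^+ k)).
Proof.
move=> /andP[s0 s1] a0 b0 x0 y0; set N := (1 - s) * a + s * b.
have N0 : 0 < N by rewrite addr_gt0// mulr_gt0//; lra.
have aN : a != 0 by rewrite gt_eqF.
have bN : b != 0 by rewrite gt_eqF.
have NN : N != 0 by rewrite gt_eqF.
have : (((1 - s) * a / N) * (x / a) + (s * b / N) * (y / b)) ^+ k.+1 <=
  ((1 - s) * a / N) * (x / a) ^+ k.+1 + (s * b / N) * (y / b) ^+ k.+1.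
  apply: exprn_convex.
  - by rewrite divr_ge0 ?(ltW N0)// mulr_ge0 ?(ltW a0)//; lra.
  - by rewrite divr_ge0 ?(ltW N0)// mulr_ge0 ?(ltW b0)//; lra.
  - by rewrite -mulrDl divff.
  - by rewrite divr_ge0 ?(ltW a0).
  - by rewrite divr_ge0 ?(ltW b0).
have -> : ((1 - s) * a / N) * (x / a) + (s * b / N) * (y / b) = ((1 - s) * x + s * y) / N.
  by field; rewrite NN aN bN.
rewrite !expr_div_n ler_pdivrMr ?exprn_gt0// => H; apply: (le_trans H).
rewrite le_eqVlt; apply/orP; left; apply/eqP.
rewrite (exprS a k) (exprS b k) (exprS N k).
by field; rewrite NN aN bN !expf_neq0.
Qed.

End powers.

(** * The inequality on the line and its integration over level sets *)

Section one_dim.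
Context {R : realType}.
Local Notation mu := (@lebesgue_measure R).
Local Notation RT := (measurableTypeR R).

Lemma lebesgue_measure_scale (c b : R) (A : set R) : 0 < c -> measurable A ->
  (mu ((fun x => (x - b) / c)%R @^-1` A) = c%:E * mu A)%E /\
  measurable ((fun x => (x - b) / c)%R @^-1` A).
Proof.
move=> c0 mA.
have m : measurable ((fun x => (x - b) / c)%R @^-1` A).
  rewrite -[X in measurable X]setTI.
  have : measurable_fun setT (fun x : RT => (x - b) / c : RT).
    by apply: measurable_funM => //; apply: measurable_funB.
  exact.
split=> //; rewrite (@lebesgue_measure_affine _ c b)//; congr (_ * mu _)%E.
apply/seteqP; split => x /=; rewrite addrK mulrAC divff ?mul1r//; exact: lt0r_neq0.
Qed.

(** Take [a] near the supremum of [A] and [b] near the infimum of [B]. The copies [(1 - s) A + s b]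
    and [(1 - s) a + s B] both lie in [C] and are placed almost side by side. The slack [e] is there
    because neither extremum need be attained. *)
Lemma brunn_minkowski1 (A B C : set R) (s M : R) : 0 < s < 1 ->
  measurable A -> measurable B -> measurable C ->
  A !=set0 -> B !=set0 -> A `<=` `[- M, M] -> B `<=` `[- M, M] ->
  (forall a b, A a -> B b -> C ((1 - s) * a + s * b)) ->
  ((1 - s)%:E * mu A + s%:E * mu B <= mu C)%E.
Proof.
move=> /andP[s0 s1] mA mB mC A0 B0 AM BM ABC.
have s1' : 0 < 1 - s by lra.
have hsA : has_sup A.
  by split => //; exists M => x /AM; rewrite /= in_itv/= => /andP[].
have hiB : has_inf B.
  by split => //; exists (- M) => x /BM; rewrite /= in_itv/= => /andP[].
apply/lee_addgt0Pr => e e0.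
have [a Aa ap] := @sup_adherent _ A e e0 hsA.
have [b Bb bq] := @inf_adherent _ B e e0 hiB.
set p := sup A in ap; set q := inf B in bq.
have Ap x : A x -> x <= p by move=> Ax; apply: ub_le_sup => //; case: hsA.
have Bq x : B x -> q <= x by move=> Bx; apply: ge_inf => //; case: hiB.
have [mA'E mA'] := @lebesgue_measure_scale (1 - s) (s * b) A s1' mA.
have [mB'E mB'] := @lebesgue_measure_scale s ((1 - s) * a) B s0 mB.
set A' := _ @^-1` A in mA'E mA'; set B' := _ @^-1` B in mB'E mB'.
rewrite -mA'E -mB'E.
(* The only place where [A'] and [B'] can overlap; its length is at most
   [(1 - s) * (p - a) + s * (b - q)], below [e]. *)
pose I := `[(1 - s) * a + s * q, (1 - s) * p + s * b]%classic.
have mI : measurable I by exact: measurable_itv.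
have muI : (mu I <= e%:E)%E.
  rewrite lebesgue_measure_itv/= lte_fin; case: ifP => _; last by rewrite lee_fin ltW.
  by rewrite -EFinD lee_fin; nra.
apply: (@le_trans _ _ (mu (A' `\` I) + mu I + mu B')%E).
  rewrite leeD2r//; apply: le_trans (measureU2 _ _ _) => //; last exact: measurableD.
  apply: le_measure; rewrite ?inE//; first by apply: measurableU => //; exact: measurableD.
  by move=> x A'x; have [Ix|Ix] := pselect (I x); [right|left].
rewrite addeAC leeD// -measureU//; last 2 first.
- exact: measurableD.
- apply/seteqP; split => // x [[A'x nIx] B'x]; apply: nIx.
  move: A'x B'x; rewrite /A' /B' /= => /Ap + /Bq.
  rewrite ler_pdivrMr// ler_pdivlMr// => h1 h2; rewrite /I/= in_itv/=.
  by apply/andP; split; lra.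
apply: le_measure; rewrite ?inE//; first by apply: measurableU => //; exact: measurableD.
move=> x [[A'x _]|B'x].
  have := ABC _ _ A'x Bb; rewrite mulrC divfK ?gt_eqF// subrK; exact.
have := ABC _ _ Aa B'x; rewrite [s * _]mulrC divfK ?gt_eqF// addrC subrK; exact.
Qed.

(** Tonelli applied to the region under the graph. Putting [0 <= t] inside the level set allows
    integration over the whole line. *)
Lemma layer_cake (f : R -> R) : measurable_fun setT f -> (forall x, 0 <= f x) ->
  measurable_fun setT (fun t : RT => mu [set x | (0 <= t < f x)%R]) /\
  (\int[mu]_x (f x)%:E = \int[mu]_t mu [set x | (0 <= t < f x)%R])%E.
Proof.
move=> mf f0.
pose A : set (RT * RT) := [set p | 0 <= p.2 < f p.1].
have mA : measurable A.
  have -> : A = (fun p : RT * RT => (0 <= p.2) && (p.2 < f p.1)) @^-1` [set true].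
    by apply/seteqP; split.
  rewrite -[X in measurable X]setTI.
  suff : measurable_fun setT (fun p : RT * RT => (0 <= p.2) && (p.2 < f p.1)) by exact.
  apply: measurable_and.
    by apply: measurable_fun_ler => //; exact: measurable_snd.
  apply: measurable_fun_ltr; first exact: measurable_snd.
  exact: (measurableT_comp mf measurable_fst).
pose G (p : RT * RT) : \bar R := (\1_A p)%:E.
have mG : measurable_fun setT G by apply/measurable_EFinP; exact: measurable_indic.
have G0 p : (0 <= G p)%E by rewrite lee_fin.
have Gt t : (\int[mu]_x G (x, t) = mu [set x | (0 <= t < f x)%R])%E.
  rewrite /G (_ : (fun x => _) = fun x => (\1_[set x | (0 <= t < f x)%R] x)%:E)//.
  rewrite integral_indic//= ?setIT//.
  have := @measurable_ysection _ _ RT RT A t mA.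
  rewrite (_ : ysection A t = [set x | (0 <= t < f x)%R])//.
  by rewrite /ysection; apply/seteqP; split => x /=; rewrite inE.
have Gx x : (\int[mu]_t G (x, t) = (f x)%:E)%E.
  transitivity (\int[mu]_t (\1_(`[0%R, f x[%classic) t)%:E)%E.
    apply: eq_integral => t _; rewrite /G !indicE; congr (_%:R%:E);
      by apply/idP/idP => /set_mem h; apply/mem_set; move: h; rewrite /A/= in_itv.
  rewrite integral_indic//= setIT lebesgue_measure_itv/= lte_fin.
  case: ifP => [_|/negbT]; first by rewrite sube0.
  by rewrite -leNgt => h; congr EFin; apply/eqP; rewrite eq_le f0 h.
split.
  rewrite (_ : (fun t => _) = fubini_G mu G); first exact: measurable_fun_fubini_tonelli_G.
  by apply/funext => t; rewrite -Gt.
under eq_integral => x _ do rewrite -Gx.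
by rewrite (@fubini_tonelli _ _ _ _ _ mu mu G mG G0); apply: eq_integral => t _.
Qed.

(** When [f] and [g] both have supremum 1, their level sets are nonempty for exactly the same
    levels, so [brunn_minkowski1] applies level by level. The result bounds an arithmetic mean of
    integrals, stronger than the geometric mean of Prékopa-Leindler. *)
Lemma level_set_inequality (f g h : R -> R) (s M : R) : 0 < s < 1 ->
  measurable_fun setT f -> measurable_fun setT g -> measurable_fun setT h ->
  (forall x, 0 <= f x <= 1) -> (forall x, 0 <= g x <= 1) -> (forall x, 0 <= h x) ->
  (forall x, 0 < f x -> - M <= x <= M) -> (forall x, 0 < g x -> - M <= x <= M) ->
  (forall t, t < 1 -> exists x, t < f x) -> (forall t, t < 1 -> exists x, t < g x) ->
  (forall (t x y : R), 0 <= t -> t < f x -> t < g y -> t < h ((1 - s) * x + s * y)) ->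
  ((1 - s)%:E * \int[mu]_x (f x)%:E + s%:E * \int[mu]_x (g x)%:E <= \int[mu]_x (h x)%:E)%E.
Proof.
move=> /[dup] s01 /andP[s0 s1] mf mg mh f01 g01 h0 fM gM f1 g1 fgh.
have f0 x : 0 <= f x by case/andP: (f01 x).
have g0 x : 0 <= g x by case/andP: (g01 x).
have s1' : 0 <= 1 - s by lra.
have [mlf ->] := layer_cake mf f0; have [mlg ->] := layer_cake mg g0.
have [mlh ->] := layer_cake mh h0.
rewrite -!ge0_integralZl_EFin//; try exact: ltW.
rewrite -ge0_integralD//; last 4 first.
- by move=> x _; rewrite mule_ge0.
- exact: measurable_funeM.
- by move=> x _; rewrite mule_ge0// lee_fin ltW.
- exact: measurable_funeM.
have ml (k : R -> R) (t : R) : measurable_fun setT k -> measurable [set x : RT | 0 <= t < k x].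
  move=> mk.
  have -> : [set x : RT | 0 <= t < k x] = (fun x => (0 <= t) && (t < k x)) @^-1` [set true].
    by apply/seteqP; split.
  rewrite -[X in measurable X]setTI.
  suff : measurable_fun setT (fun x : RT => (0 <= t) && (t < k x)) by exact.
  apply: measurable_and; first by apply: measurable_fun_ler.
  by apply: measurable_fun_ltr => //; exact: measurable_cst.
apply: ge0_le_integral => //.
- by move=> t _; rewrite adde_ge0// mule_ge0// lee_fin ltW.
- by apply: emeasurable_funD; exact: measurable_funeM.
(* Outside [0 <= t < 1] the level sets of [f] and [g] are empty and the left side is zero. *)
- move=> t _; have [t01|t01] := boolP (0 <= t < 1); last first.
    have e (k : R -> R) : (forall x, 0 <= k x <= 1) -> [set x | (0 <= t < k x)%R] = set0.
      move=> k01; apply/seteqP; split => // x /= /andP[t0 tk].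
      case/negP: t01; rewrite t0/=; apply: lt_le_trans tk _; by case/andP: (k01 x).
    by rewrite (e f)// (e g)// measure0 !mule0 adde0.
  move: t01 => /andP[t0 t1].
  apply: (@brunn_minkowski1 _ _ _ s M) => //; try exact: ml.
  + by have [x tx] := f1 _ t1; exists x; rewrite /= t0.
  + by have [x tx] := g1 _ t1; exists x; rewrite /= t0.
  + by move=> x /= /andP[_ tx]; rewrite in_itv/= fM// (le_lt_trans t0).
  + by move=> x /= /andP[_ tx]; rewrite in_itv/= gM// (le_lt_trans t0).
  + by move=> a b /= /andP[_ ta] /andP[_ tb]; rewrite t0/=; exact: fgh.
Qed.

End one_dim.

(** * Slices and the induction on the dimension *)

Section brunn_minkowski.
Context {R : realType}.
Local Notation mu := (@lebesgue_measure R).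
Local Notation RT := (measurableTypeR R).

Definition slice n (A : set 'rV[R]_n.+1) (x : R) : set 'rV[R]_n :=
  [set t | A (row_mx (x%:M : 'rV[R]_1) t)].

Definition slice_vol n (A : set 'rV[R]_n.+1) (x : R) : R := vol (slice A x).

Lemma boxed_indic n (M : R) (A : set 'rV[R]_n) : A `<=` box M ->
  boxed 1 M (fun z => (\1_A z)%:E).
Proof.
move=> AM z; rewrite !lee_fin mul1r; split => //.
rewrite !indicE ler_nat; case: (boolP (z \in A)) => // /set_mem/AM zM.
by rewrite (mem_set zM).
Qed.

Lemma rvmset_slice n (A : set 'rV[R]_n.+1) (x : R) : rvmset A -> rvmset (slice A x).
Proof. by move=> mA; exact: (rvmeas_slice1 x mA). Qed.

Lemma slice_box n (A : set 'rV[R]_n.+1) (x M : R) : A `<=` box M ->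
  slice A x `<=` box M.
Proof.
by move=> AM t /AM h i; have := h (rshift 1 i); rewrite (@row_mxEr _ 1 1 n).
Qed.

Lemma slice_supp n (A : set 'rV[R]_n.+1) (x M : R) t : A `<=` box M ->
  slice A x t -> - M <= x <= M.
Proof.
move=> AM /AM h; have := h (@lshift 1 n 0); rewrite (@row_mxEl _ 1 1 n) mxE eqxx mulr1n.
by rewrite ler_norml.
Qed.

Lemma iint_vol n (M : R) (A : set 'rV[R]_n) : 0 <= M -> rvmset A -> A `<=` box M ->
  iint (fun z => (\1_A z)%:E) = (vol A)%:E.
Proof.
move=> M0 mA AM; rewrite fineK// ge0_fin_numE; last by apply: iint_ge0 => z; rewrite lee_fin.
exact: le_lt_trans (iint_boxed ler01 M0 mA (boxed_indic AM)) (ltry _).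
Qed.

Lemma vol_ge0 n (A : set 'rV[R]_n) : 0 <= vol A.
Proof. by apply: fine_ge0; apply: iint_ge0 => z; rewrite lee_fin. Qed.

Lemma vol_box n (M : R) (A : set 'rV[R]_n) : 0 <= M -> rvmset A -> A `<=` box M ->
  vol A <= (2 * M) ^+ n.
Proof.
move=> M0 mA AM; rewrite -lee_fin -(iint_vol M0 mA AM).
by have := iint_boxed ler01 M0 mA (boxed_indic AM); rewrite mul1r.
Qed.

Lemma vol_set0 n : vol (set0 : set 'rV[R]_n) = 0.
Proof.
rewrite /vol (_ : (fun z => _) = fun=> 0%E); last first.
  by apply/funext => z; rewrite indic0.
suff -> : iint (fun _ : 'rV[R]_n => 0%E) = 0%E by [].
by elim: n => [//|n IH] /=; rewrite integral0_eq.
Qed.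

Lemma measurable_slice_vol n (M : R) (A : set 'rV[R]_n.+1) : 0 <= M -> rvmset A -> A `<=` box M ->
  measurable_fun setT (slice_vol A : RT -> R).
Proof.
move=> M0 mA AM; apply/measurable_EFinP.
have := measurable_iint_slice mA (fun z => _ : 0 <= (\1_A z)%:E)%E.
rewrite (_ : (fun x : RT => iint _) = EFin \o slice_vol A).
  by apply => z; rewrite lee_fin.
apply/funext => x; rewrite /= /slice_vol -(iint_vol M0)//.
- exact: rvmset_slice.
- exact: slice_box.
Qed.

Lemma int_slice_vol n (M : R) (A : set 'rV[R]_n.+1) : 0 <= M -> rvmset A -> A `<=` box M ->
  (\int[mu]_x (slice_vol A x)%:E = (vol A)%:E)%E.
Proof.
move=> M0 mA AM; rewrite -(iint_vol M0 mA AM) /=; apply: eq_integral => x _.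
by rewrite /slice_vol -(iint_vol M0)//; [exact: rvmset_slice|exact: slice_box].
Qed.

Lemma slice_vol_nonempty n (A : set 'rV[R]_n.+1) x : 0 < slice_vol A x -> slice A x !=set0.
Proof.
move=> v0; apply/set0P; apply: contraTneq v0 => e.
by rewrite /slice_vol e vol_set0 ltxx.
Qed.

Lemma slice_vol_supp n (A : set 'rV[R]_n.+1) (x M : R) : A `<=` box M ->
  0 < slice_vol A x -> - M <= x <= M.
Proof.
by move=> AM /slice_vol_nonempty[t]; exact: slice_supp.
Qed.

Lemma normalize_sup (f : R -> R) (C : R) : (forall x, f x <= C) -> (exists x, 0 < f x) ->
  exists2 S, 0 < S & (forall x, f x <= S) /\ (forall t, t < 1 -> exists x, t < f x / S).
Proof.
move=> fC [x0 fx0].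
have hs : has_sup (range f).
  by split; [exists (f x0), x0|exists C => _ [x _ <-]].
have fS x : f x <= sup (range f) by apply: ub_le_sup; [case: hs|exists x].
have S0 : 0 < sup (range f) by exact: lt_le_trans (fS x0).
exists (sup (range f)) => //; split=> // t t1.
have e0 : 0 < (1 - t) * sup (range f) by rewrite mulr_gt0// subr_gt0.
have [_ [x _ <-] fx] := sup_adherent e0 hs.
by exists x; rewrite ltr_pdivlMr//; lra.
Qed.

Lemma scale_row_mx_comb n (s x y : R) (t u : 'rV[R]_n) :
  (1 - s) *: (row_mx (x%:M : 'rV[R]_1) t : 'rV[R]_n.+1) + s *: row_mx (y%:M : 'rV[R]_1) u =
  row_mx (((1 - s) * x + s * y)%:M : 'rV[R]_1) ((1 - s) *: t + s *: u).
Proof.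
rewrite raddfD/= -!scale_scalar_mx.
rewrite -(@add_row_mx R 1 1 n) -!(@scale_row_mx R 1 1 n).
by [].
Qed.

(** Induction on the dimension through slice volumes. Normalized by their suprema, these satisfy
    [level_set_inequality], whose pointwise hypothesis is the statement one dimension lower;
    [weighted_power_mean] then undoes the normalization. Letting [a] and [b] be lower bounds for the
    roots allows the induction to be used on slices at any smaller size. *)
Theorem brunn_minkowski n (A B C : set 'rV[R]_n.+1) (s M a b : R) : 0 < s < 1 -> 0 <= M ->
  rvmset A -> rvmset B -> rvmset C -> A `<=` box M -> B `<=` box M -> C `<=` box M ->
  (forall x y, A x -> B y -> C ((1 - s) *: x + s *: y)) ->
  0 < a -> 0 < b -> a ^+ n.+1 <= vol A -> b ^+ n.+1 <= vol B ->
  ((1 - s) * a + s * b) ^+ n.+1 <= vol C.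
Proof.
move=> /[dup] s01 /andP[s0 s1] M0; have s1' : 0 < 1 - s by lra.
elim: n A B C a b => [|n IH] A B C a b mA mB mC AM BM CM ABC a0 b0 aA bB.
  (* In dimension one the volume is the Lebesgue measure of the trace [P D] on the line. *)
  pose P (D : set 'rV[R]_1) : set R := [set x | D (row_mx (x%:M : 'rV[R]_1) (0 : 'rV[R]_0))].
  have PE D : rvmset D -> D `<=` box M -> measurable (P D) /\ mu (P D) = (vol D)%:E.
    move=> mD DM.
    have mP : measurable (P D).
      move/rvmsetP : (mD) => /(_ _ RT (fun x => row_mx (x%:M : 'rV[R]_1) (0 : 'rV[R]_0))).
      by apply; apply: (@row_mx_meas _ _ _ 0) => // i; exact: measurable_cst.
    split=> //; rewrite -(iint_vol M0 mD DM) /=.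
    by rewrite -[in LHS](setIT (P D)) -integral_indic.
  have [mPA vA] := PE A mA AM; have [mPB vB] := PE B mB BM; have [mPC vC] := PE C mC CM.
  have PM D : D `<=` box M -> P D `<=` `[- M, M].
    by move=> DM x h; rewrite /= in_itv/=; exact: (slice_supp DM h).
  have P0 D : (0 < mu (P D))%E -> P D !=set0.
    by move=> m0; apply/set0P; apply: contraTneq m0 => ->; rewrite measure0 ltxx.
  have := @brunn_minkowski1 R (P A) (P B) (P C) s M s01 mPA mPB mPC.
  rewrite vA vB vC -!EFinM -EFinD lee_fin !expr1 in aA bB * => bm.
  apply: le_trans (bm _ _ _ _ _).
  - by apply: lerD; apply: ler_wpM2l => //; exact: ltW.
  - by apply: P0; rewrite vA lte_fin (lt_le_trans a0).
  - by apply: P0; rewrite vB lte_fin (lt_le_trans b0).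
  - exact: PM.
  - exact: PM.
  - move=> x y Ax By; have := ABC _ _ Ax By.
    by rewrite (scale_row_mx_comb s x y 0 0) !scaler0 addr0.
have ge0 D x : 0 <= @slice_vol n.+1 D x by exact: vol_ge0.
have leC (D : set 'rV[R]_n.+2) x : rvmset D -> D `<=` box M -> slice_vol D x <= (2 * M) ^+ n.+1.
  by move=> mD DM; apply: vol_box => //; [exact: rvmset_slice|exact: slice_box].
have pos (D : set 'rV[R]_n.+2) c : rvmset D -> D `<=` box M -> 0 < c -> c ^+ n.+2 <= vol D ->
    exists x, 0 < slice_vol D x.
  move=> mD DM c0 cD; apply: contrapT => /forallNP D0.
  have : 0 < vol D by exact: lt_le_trans (exprn_gt0 _ c0) cD.
  rewrite -lte_fin -(int_slice_vol M0 mD DM) integral0_eq ?ltxx// => x _.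
  by congr EFin; apply/eqP; rewrite eq_le ge0 andbT leNgt; exact/negP.
have [Sf Sf0 [fS f1]] := normalize_sup (fun x => leC A x mA AM) (pos _ _ mA AM a0 aA).
have [Sg Sg0 [gS g1]] := normalize_sup (fun x => leC B x mB BM) (pos _ _ mB BM b0 bB).
(* [p] and [q] are the linear sizes of the largest slices; [N] is the size their combination must
   reach in [C], so [N ^+ n.+1] normalizes its slice volumes. *)
have [p p0 pE] := exists_root n Sf0; have [q q0 qE] := exists_root n Sg0.
pose N := (1 - s) * p + s * q.
have N0 : 0 < N by rewrite addr_gt0// mulr_gt0.
have Nn0 : 0 < N ^+ n.+1 by rewrite exprn_gt0.
have intS (D : set 'rV[R]_n.+2) (S : R) : rvmset D -> D `<=` box M -> 0 < S ->
    (\int[mu]_x (slice_vol D x / S)%:E = (vol D / S)%:E)%E.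
  move=> mD DM S0; under eq_integral => x _ do rewrite mulrC EFinM.
  rewrite ge0_integralZl_EFin ?invr_ge0 ?ltW//.
  - by rewrite (int_slice_vol M0 mD DM) -EFinM mulrC.
  - by move=> x _; rewrite lee_fin; exact: ge0.
  - by apply/measurable_EFinP; exact: (measurable_slice_vol M0 mD DM).
have mS (D : set 'rV[R]_n.+2) (S : R) : rvmset D -> D `<=` box M ->
    measurable_fun setT (fun x : RT => slice_vol D x / S).
  by move=> mD DM; apply: measurable_funM => //; exact: (measurable_slice_vol M0 mD DM).
have := @level_set_inequality R (fun x => slice_vol A x / Sf) (fun x => slice_vol B x / Sg)
  (fun x => slice_vol C x / N ^+ n.+1) s M s01 (mS _ _ mA AM) (mS _ _ mB BM) (mS _ _ mC CM).
rewrite !intS// -!EFinM -EFinD lee_fin => lsi.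
have {lsi} main : (1 - s) * (vol A / Sf) + s * (vol B / Sg) <= vol C / N ^+ n.+1.
  apply: lsi => //.
  - by move=> x; rewrite divr_ge0 ?(ltW Sf0)// ler_pdivrMr// mul1r fS.
  - by move=> x; rewrite divr_ge0 ?(ltW Sg0)// ler_pdivrMr// mul1r gS.
  - by move=> x; rewrite divr_ge0 ?(ltW Nn0).
  - by move=> x; rewrite pmulr_lgt0 ?invr_gt0//; exact: slice_vol_supp.
  - by move=> x; rewrite pmulr_lgt0 ?invr_gt0//; exact: slice_vol_supp.
  - move=> t x y t0 tx ty; set z := (1 - s) * x + s * y.
    (* At the smaller of the two normalized values, [r ^+ n.+1], the slices have volumes at least
       [(r * p) ^+ n.+1] and [(r * q) ^+ n.+1], and the combined size is [r * N]. *)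
    pose t' := Order.min (slice_vol A x / Sf) (slice_vol B y / Sg).
    have tt' : t < t' by rewrite lt_min tx ty.
    have t'0 : 0 < t' by exact: le_lt_trans tt'.
    have [r r0 rE] := exists_root n t'0.
    apply: (lt_le_trans tt'); rewrite ler_pdivlMr// -rE -exprMn.
    rewrite [r * N](_ : _ = (1 - s) * (r * p) + s * (r * q)); last by rewrite /N; ring.
    apply: (IH (slice A x) (slice B y) (slice C z)); try exact: rvmset_slice;
      try exact: slice_box; try exact: mulr_gt0.
    + by move=> u w Au Bw; rewrite /slice/= -scale_row_mx_comb; exact: ABC.
    + by rewrite exprMn rE pE -ler_pdivlMr// ge_min lexx.
    + by rewrite exprMn rE qE -ler_pdivlMr// ge_min lexx orbT.
apply: (le_trans (weighted_power_mean n.+1 s01 p0 q0 (ltW a0) (ltW b0))).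
rewrite -/N mulrC -ler_pdivlMr//; apply: le_trans main; rewrite pE qE.
by apply: lerD; apply: ler_wpM2l; rewrite ?(ltW s0) ?(ltW s1')// ler_wpM2r// invr_ge0 ltW.
Qed.

End brunn_minkowski.

(** * Concave profiles on the line *)

Section nice.
Context {R : realType}.
Local Notation mu := (@lebesgue_measure R).
Local Notation RT := (measurableTypeR R).
Implicit Types u v : R -> R.

(** Boundedness together with bounded support is stable under multiplication by [t] and by
    indicators, so first moments and half-line restrictions stay integrable. *)
Definition nice u := measurable_fun setT (u : RT -> R) /\
  exists C M, forall x, `|u x| <= C /\ (u x != 0 -> `|x| <= M).

Definition lint u : R := (\int[mu]_x u x)%R.

Lemma nice_integrable u : nice u -> mu.-integrable setT (EFin \o u).
Proof.
move=> [mu' [C [M uCM]]].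
pose g (x : R) : R := C * \1_(`[- M, M]%classic) x.
have gi : mu.-integrable setT (EFin \o g).
  rewrite (_ : EFin \o g = fun x => (C%:E * (\1_(`[- M, M]%classic) x)%:E)%E)//.
  by apply: integrableZl => //; exact: integrable_indic_itv.
apply: (le_integrable measurableT _ _ gi); first exact/measurable_EFinP.
move=> x _; rewrite /= lee_fin /g; have [uC uM] := uCM x.
have [->|u0] := eqVneq (u x) 0; first by rewrite normr0.
rewrite indicE mem_set ?mulr1; first exact: le_trans (ler_norm _).
by rewrite /= in_itv/= -ler_norml uM.
Qed.

Lemma niceD u v : nice u -> nice v -> nice (fun x => u x + v x).
Proof.
move=> [mu' [C [M uCM]]] [mv [C' [M' vCM]]]; split; first exact: measurable_funD.
exists (C + C'), (Num.max M M') => x.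
have [uC uM] := uCM x; have [vC vM] := vCM x; split.
  exact: le_trans (ler_normD _ _) (lerD uC vC).
have [u0|u0] := eqVneq (u x) 0; last by rewrite le_max uM.
by rewrite u0 add0r => v0; rewrite le_max vM// orbT.
Qed.

Lemma niceM u v : nice u -> measurable_fun setT (v : RT -> R) ->
  (forall M, exists C, forall x, `|x| <= M -> `|v x| <= C) -> nice (fun x => v x * u x).
Proof.
move=> [mu' [C [M uCM]]] mv bv; split; first exact: measurable_funM.
have [B vB] := bv M; exists (`|B| * C), M => x.
have [uC uM] := uCM x; split; last first.
  by move=> vu; apply: uM; apply: contraNneq vu => ->; rewrite mulr0.
have [->|u0] := eqVneq (u x) 0.
  by rewrite mulr0 normr0 mulr_ge0// (le_trans _ uC).
by rewrite normrM ler_pM//; apply: le_trans (ler_norm _); exact/vB/uM.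
Qed.

Lemma niceZ (c : R) u : nice u -> nice (fun x => c * u x).
Proof. by move=> nu; apply: niceM => // M; exists `|c|. Qed.

Lemma nice_idM u : nice u -> nice (fun x => x * u x).
Proof. by move=> nu; apply: niceM => // M; exists M. Qed.

Lemma nice_indic (D : set R) u : measurable D -> nice u -> nice (fun x => \1_D x * u x).
Proof.
move=> mD nu; apply: niceM => // M; exists 1 => x _.
by rewrite indicE; case: (_ \in _); rewrite ?normr0 ?normr1.
Qed.

Lemma nice_itv (a b : R) : nice (\1_(`[a, b]%classic)).
Proof.
split; first by apply: measurable_indic.
exists 1, (Num.max `|a| `|b|) => x; split.
  by rewrite indicE; case: (_ \in _); rewrite ?normr0 ?normr1.
rewrite indicE; case: (boolP (_ \in _)) => [/set_mem|]; last by rewrite eqxx.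
rewrite /= in_itv/= => /andP[ax xb] _; rewrite le_max.
have [x0|x0] := leP 0 x.
  by rewrite (ger0_norm x0) (le_trans xb (ler_norm b)) orbT.
by rewrite (ltr0_norm x0) -(normrN a) (le_trans _ (ler_norm (- a)))// lerN2.
Qed.

Lemma lintD u v : nice u -> nice v -> lint (fun x => u x + v x) = lint u + lint v.
Proof. by move=> nu nv; rewrite /lint RintegralD//; exact: nice_integrable. Qed.

Lemma lintZ (c : R) u : nice u -> lint (fun x => c * u x) = c * lint u.
Proof. by move=> nu; rewrite /lint RintegralZl//; exact: nice_integrable. Qed.

Lemma le_lint u v : nice u -> nice v -> (forall x, u x <= v x) -> lint u <= lint v.
Proof. by move=> nu nv uv; apply: le_Rintegral => //; exact: nice_integrable. Qed.

Lemma lint_ge0 u : (forall x, 0 <= u x) -> 0 <= lint u.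
Proof. by move=> u0; apply: Rintegral_ge0. Qed.

(** Integrate the sign condition: since the masses agree, the terms in [c] cancel and only the
    difference of moments is left. *)
Lemma moment_compare u v (c : R) : nice u -> nice v -> lint u = lint v ->
  (forall t, 0 <= (c - t) * (u t - v t)) ->
  lint (fun t => t * u t) <= lint (fun t => t * v t).
Proof.
move=> nu nv uv h.
have := @le_lint (fun t => c * v t + t * u t) (fun t => c * u t + t * v t) _ _ _.
rewrite !lintD ?lintZ ?uv ?lerD2l//; try exact: niceZ; try exact: nice_idM.
apply; [apply: niceD|apply: niceD|]; try exact: niceZ; try exact: nice_idM.
by move=> x; have := h x; rewrite -subr_ge0; lra.
Qed.

(** Slice volumes of a cone with apex at height [h], normalized to 1 at height 0 and truncated to
    [[a, b]]; [k] is the dimension of the slices. *)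
Definition cone (a b h : R) k (t : R) : R := \1_(`[a, b]%classic) t * (1 - t / h) ^+ k.

Lemma nice_cone (a b h : R) k : nice (cone a b h k).
Proof.
rewrite /cone; under eq_fun do rewrite mulrC.
apply: niceM; first exact: nice_itv.
  apply: measurable_funX; apply: measurable_funB => //; exact: measurable_funM.
move=> M; exists ((1 + M / `|h|) ^+ k) => x xM.
rewrite normrX lerXn2r// ?nnegrE.
  by rewrite addr_ge0// divr_ge0// (le_trans _ xM).
by rewrite (le_trans (ler_normB _ _))// normr1 lerD2l normrM normfV ler_wpM2r.
Qed.

Lemma lint_cone (a b h : R) k : a <= b -> h != 0 ->
  lint (cone a b h k) = h / k.+1%:R * ((1 - a / h) ^+ k.+1 - (1 - b / h) ^+ k.+1).
Proof.
move=> ab h0.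
pose F (t : R) := - (h / k.+1%:R) * (1 - t / h) ^+ k.+1.
have -> : lint (cone a b h k) = (\int[mu]_(x in `[a, b]) (1 - x / h) ^+ k)%R.
  rewrite [RHS]Rintegral_mkcond /lint; apply: eq_Rintegral => x _.
  by rewrite /cone patchE indicE; case: ifP; rewrite ?mul1r ?mul0r.
move: ab; rewrite le_eqVlt => /predU1P[->|ab].
  by rewrite set_itv1 Rintegral_set1 subrr mulr0.
have dF (x : R) : is_derive x 1 F ((1 - x / h) ^+ k).
  pose G : R -> R := fun t => 1 - t / h.
  have dG : is_derive x 1 G (- h^-1).
    rewrite (_ : G = cst 1 - h^-1 \*: id); last by apply/funext => t; rewrite /G /= mulrC.
    by apply: is_derive_eq; rewrite sub0r; congr (- _); exact: mulr1.
  have -> : F = (- (h / k.+1%:R)) \*: (G ^+ k.+1).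
    by apply/funext => t; rewrite /F /= exprfctE.
  apply: is_derive_eq; rewrite /GRing.scale/= /G.
  by field; rewrite h0 nat1r pnatr_eq0.
have cF : continuous F.
  by move=> x; apply: differentiable_continuous; apply/derivable1_diffP; exact: ex_derive.
have cf : continuous (fun x : R => (1 - x / h) ^+ k).
  move=> x; apply: (@continuous_comp R R R (fun x => 1 - x / h) (fun y : R => y ^+ k) x);
    last exact: exprn_continuous.
  apply: cvgB; first exact: cvg_cst.
  exact: mulrr_continuous.
rewrite /Rintegral (@continuous_FTC2 _ (fun x => (1 - x / h) ^+ k) F a b ab)//.
- by rewrite -EFinB /= /F; ring.
- exact: continuous_subspaceT.
- split.
  + by move=> y _; exact: ex_derive.
  + by apply: cvg_at_right_filter; exact: cF.
  + by apply: cvg_at_left_filter; exact: cF.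
- by move=> y _; rewrite derive1E; apply: derive_val.
Qed.

End nice.

(** * Comparison of a root-concave profile with a cone *)

Section profile.
Context {R : realType}.
Implicit Types f : R -> R.

(** Concavity of the [k]-th root of [f] on the set where [f] is positive, with [a] and [b] standing
    for lower bounds of the roots. *)
Definition root_concave k f := forall s x y a b : R, 0 < s < 1 -> 0 < a -> 0 < b ->
  a ^+ k <= f x -> b ^+ k <= f y -> ((1 - s) * a + s * b) ^+ k <= f ((1 - s) * x + s * y).

Definition fpos f (t : R) : R := \1_(`[0, +oo[%classic) t * f t.
Definition fneg f (t : R) : R := \1_(`]-oo, 0[%classic) t * f t.

Lemma fposE f t : fpos f t = if 0 <= t then f t else 0.
Proof.
rewrite /fpos indicE; case: ifP => t0.
  by rewrite mem_set ?mul1r//= in_itv/= t0.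
by rewrite memNset ?mul0r//= in_itv/= t0.
Qed.

Lemma fnegE f t : fneg f t = if t < 0 then f t else 0.
Proof.
rewrite /fneg indicE; case: ifP => t0.
  by rewrite mem_set ?mul1r//= in_itv/= t0.
by rewrite memNset ?mul0r//= in_itv/= t0.
Qed.

Lemma coneE (a b h : R) k t : cone a b h k t = if a <= t <= b then (1 - t / h) ^+ k else 0.
Proof.
rewrite /cone indicE; case: ifP => t0.
  by rewrite mem_set ?mul1r//= in_itv/= t0.
by rewrite memNset ?mul0r//= in_itv/= t0.
Qed.

Lemma nice_fpos f : nice f -> nice (fpos f).
Proof. by move=> nf; apply: nice_indic => //; exact: measurable_itv. Qed.

Lemma nice_fneg f : nice f -> nice (fneg f).
Proof. by move=> nf; apply: nice_indic => //; exact: measurable_itv. Qed.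

Lemma fpos_fneg f t : f t = fpos f t + fneg f t.
Proof. by rewrite fposE fnegE; case: ltP => _; rewrite ?addr0 ?add0r. Qed.

Lemma lint_fpos_fneg f : nice f -> lint f = lint (fpos f) + lint (fneg f).
Proof.
move=> nf; rewrite -lintD; [|exact: nice_fpos|exact: nice_fneg].
by congr lint; apply/funext => t; exact: fpos_fneg.
Qed.

Lemma lint_cone_apex k (h : R) : h != 0 -> 0 <= h -> lint (cone 0 h h k) = h / k.+1%:R.
Proof.
move=> h0 hge; rewrite lint_cone// mul0r subr0 divff// subrr expr1n expr0n/= subr0.
by rewrite mulr1.
Qed.

(** A convex body contains the cone over its section at 0 with apex at any of its points; [y] is the
    height of that point. This is what bounds heights above [W] by [h]. *)
Lemma mass_ge_cone_pos k f (y : R) : nice f -> (forall t, 0 <= f t) -> 0 < y ->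
  (forall t, 0 <= t <= y -> f 0 * (1 - t / y) ^+ k <= f t) ->
  f 0 * (y / k.+1%:R) <= lint (fpos f).
Proof.
move=> nf f0 y0 fy; rewrite -lint_cone_apex ?gt_eqF //; last exact: ltW.
rewrite -lintZ; last exact: nice_cone.
apply: le_lint; [exact/niceZ/nice_cone|exact: nice_fpos|move=> t].
rewrite coneE fposE; case: ifP => [ty|_]; first by case/andP: (ty) => -> _; exact: fy.
by rewrite mulr0; case: ifP.
Qed.

Lemma mass_gt0 k f (y : R) : nice f -> (forall t, 0 <= f t) -> 0 < f 0 -> y < 0 ->
  (forall t, y <= t <= 0 -> f 0 * (1 - t / y) ^+ k <= f t) -> 0 < lint f.
Proof.
move=> nf f0 fp y0 fy; apply: (@lt_le_trans _ _ (lint (fun t => f 0 * cone y 0 y k t))).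
  rewrite lintZ; last exact: nice_cone.
  rewrite lint_cone ?lt_eqF ?ltW// divff ?lt_eqF// subrr mul0r subr0 expr1n expr0n/= sub0r.
  by rewrite mulr_gt0// mulrN mulr1 oppr_gt0 pmulr_llt0// invr_gt0 ltr0n.
apply: le_lint => //; first exact/niceZ/nice_cone.
by move=> t; rewrite coneE; case: ifP => [|_]; [exact: fy|rewrite mulr0].
Qed.

(* Otherwise the chord through [(x, f x ^ (1/k))] and [(0, f 0 ^ (1/k))] would confine the
   positive half under a cone of height less than [h]. *)
Lemma neg_le_cone k f (h x : R) : nice f -> (forall t, 0 <= f t) -> 0 < f 0 ->
  root_concave k.+1 f -> 0 < h -> f 0 * (h / k.+2%:R) <= lint (fpos f) -> x < 0 ->
  f x <= f 0 * (1 - x / h) ^+ k.+1.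
Proof.
move=> nf f0 fp cf h0 Vh x0; rewrite leNgt; apply/negP => fx.
have [p p0 pE] := exists_root k fp.
have xh : 0 < 1 - x / h by rewrite subr_gt0 ltr_pdivrMr// mul1r (lt_trans x0).
have fx0 : 0 < f x by apply: lt_trans fx; rewrite mulr_gt0// exprn_gt0.
have [q q0 qE] := exists_root k fx0.
have pq : p * (1 - x / h) < q.
  rewrite -(@ltr_pXn2r _ k.+1)// ?nnegrE ?mulr_ge0 ?ltW//.
  by rewrite exprMn pE qE.
(* The zero of the line through [(x, q)] and [(0, p)]. *)
pose h' := p * - x / (q - p).
have qp : 0 < q - p.
  rewrite subr_gt0; apply: lt_trans pq; rewrite ltr_pMr// ltrDl oppr_gt0 pmulr_llt0// invr_gt0//.
have h'0 : 0 < h' by rewrite divr_gt0// mulr_gt0// oppr_gt0.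
have h'h : h' < h.
  rewrite ltr_pdivrMr//; have : p * (1 - x / h) * h < q * h by rewrite ltr_pM2r.
  have -> : p * (1 - x / h) * h = p * h - p * x by field; rewrite gt_eqF.
  lra.
have key t : 0 <= t -> 0 < f t -> t <= h' /\ f t <= f 0 * (1 - t / h') ^+ k.+1.
  move=> t0 ft.
  have [u u0 uE] := exists_root k ft.
  have up : u <= p * (1 - t / h').
    have -> : p * (1 - t / h') = p + t * (q - p) / x.
      by rewrite /h'; field; rewrite (lt_eqF x0) (gt_eqF qp) (gt_eqF p0).
    move: t0; rewrite le_eqVlt => /predU1P[t0|t0].
      rewrite -t0 in uE *; rewrite !mul0r addr0.
      rewrite -(@ler_pXn2r _ k.+1)// ?nnegrE ?(ltW u0) ?(ltW p0)//.
      by rewrite uE pE.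
    have tx : 0 < t - x by lra.
    (* The weight that writes 0 as a convex combination of [x] and [t]. *)
    have s01 : 0 < - x / (t - x) < 1.
      by rewrite divr_gt0 ?oppr_gt0//= ltr_pdivrMr// mul1r; lra.
    have := cf (- x / (t - x)) x t q u s01 q0 u0.
    rewrite qE uE => /(_ (lexx _) (lexx _)).
    have -> : (1 - - x / (t - x)) * x + - x / (t - x) * t = 0.
      by field; rewrite gt_eqF.
    have -> : (1 - - x / (t - x)) * q + - x / (t - x) * u = (t * q - x * u) / (t - x).
      by field; rewrite gt_eqF.
    rewrite -pE ler_pXn2r// ?nnegrE ?(ltW p0)//; last first.
      by apply: ltW; rewrite divr_gt0// -mulNr addr_gt0// mulr_gt0// oppr_gt0.
    rewrite ler_pdivrMr// => H.
    have -> : p + t * (q - p) / x = (p * x + t * (q - p)) / x by field; rewrite lt_eqF.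
    by rewrite ler_ndivlMr//; lra.
  have th : 0 < 1 - t / h'.
    by rewrite -(pmulr_rgt0 _ p0); exact: lt_le_trans up.
  split; first by move: th; rewrite subr_gt0 ltr_pdivrMr// mul1r => /ltW.
  by rewrite -uE -pE -exprMn lerXn2r// nnegrE ?(ltW u0)// mulr_ge0// ltW.
have : lint (fpos f) <= f 0 * (h' / k.+2%:R).
  rewrite -lint_cone_apex ?gt_eqF //; last exact: ltW.
  rewrite -lintZ; last exact: nice_cone.
  apply: le_lint; [exact: nice_fpos|exact/niceZ/nice_cone|move=> t].
  rewrite coneE fposE; case: ifP => [t0|t0]; last first.
    by rewrite ?t0 /= mulr0.
  have [ft|ft] := ltP 0 (f t).
    by have [th' fth'] := key _ t0 ft; rewrite th'.
  apply: (le_trans ft); case: ifP => [th'|_]; rewrite ?mulr0//.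
  by rewrite mulr_ge0 ?(ltW fp)// exprn_ge0// subr_ge0 ler_pdivrMr// mul1r.
move=> /(le_trans Vh); rewrite ler_pM2l// ler_pM2r ?invr_gt0 ?ltr0n//.
by rewrite leNgt h'h.
Qed.

(** The crossing point is the last height at which [f] dominates the cone. Before it, the root of
    [f] lies above a chord starting at 0, where both profiles agree, and ending above the cone,
    whose root is affine. *)
Lemma cone_crossing k f (h : R) : (forall t, 0 <= f t) -> 0 < f 0 ->
  root_concave k.+1 f -> 0 < h -> (forall t, 0 < f t -> t <= h) ->
  exists c, forall t, 0 <= (c - t) * (fpos f t - f 0 * cone 0 h h k.+1 t).
Proof.
move=> f0 fp cf h0 fh.
have [p p0 pE] := exists_root k fp.
(* Positivity of [f t] is required separately because the cone vanishes at [h], while [root_concave]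
   needs positive roots. *)
pose T := [set t | 0 <= t <= h /\ 0 < f t /\ f 0 * (1 - t / h) ^+ k.+1 <= f t].
have hsT : has_sup T.
  split; first by exists 0; rewrite /T/= lexx ltW//= mul0r subr0 expr1n mulr1.
  by exists h => t [/andP[]].
exists (sup T) => t; rewrite fposE coneE.
case: (leP 0 t) => t0 /=; last by rewrite mulr0 subr0 mulr0.
have [th|ht] := leP t h; last first.
  suff -> : f t = 0 by rewrite mulr0 subr0 mulr0.
  by apply/eqP; rewrite eq_le f0 andbT leNgt; apply/negP => /fh; rewrite leNgt ht.
have [tT|Tt] := ltP t (sup T).
  rewrite mulr_ge0 ?subr_ge0 ?(ltW tT)//.
  have [t1 [/andP[t10 t1h] [ft1 ft1']] tt1] : exists2 t1, T t1 & t < t1.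
    have e0 : 0 < sup T - t by rewrite subr_gt0.
    by have [t1 Tt1 h1] := sup_adherent e0 hsT; exists t1 => //; move: h1; rewrite subKr.
  move: t0; rewrite le_eqVlt => /predU1P[<-|t0].
    by rewrite mul0r subr0 expr1n mulr1.
  have t1p : 0 < t1 by exact: lt_trans tt1.
  have [u u0 uE] := exists_root k ft1.
  have s01 : 0 < t / t1 < 1 by rewrite divr_gt0//= ltr_pdivrMr// mul1r.
  have := cf (t / t1) 0 t1 p u s01 p0 u0.
  rewrite pE uE mulr0 add0r divfK ?gt_eqF// => /(_ (lexx _) (lexx _)).
  apply: le_trans; rewrite -pE -exprMn.
  have t1h' : 0 <= 1 - t1 / h by rewrite subr_ge0 ler_pdivrMr// mul1r.
  have pu : p * (1 - t1 / h) <= u.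
    rewrite -(@ler_pXn2r _ k.+1)// ?nnegrE ?(ltW u0)//; last by rewrite mulr_ge0// ltW.
    by rewrite exprMn pE uE.
  rewrite lerXn2r// ?nnegrE.
  - by rewrite mulr_ge0 ?(ltW p0)// subr_ge0 ler_pdivrMr// mul1r.
  - by case/andP: s01 => s0 s1; rewrite addr_ge0// mulr_ge0 ?(ltW p0) ?(ltW u0) ?subr_ge0 ?ltW.
  - have -> : p * (1 - t / h) = (1 - t / t1) * p + t / t1 * (p * (1 - t1 / h)).
      by field; rewrite !gt_eqF.
    by rewrite lerD2l ler_wpM2l//; case/andP: s01 => /ltW.
have [->|Ttn] := eqVneq t (sup T); first by rewrite subrr mul0r.
have {}Tt : sup T < t by rewrite lt_neqAle eq_sym Ttn.
rewrite mulr_le0// subr_le0 ?(ltW Tt)// leNgt; apply/negP => ft.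
have : t <= sup T.
  apply: ub_le_sup; first by case: hsT.
  split; first by rewrite t0 th.
  split; last exact: ltW.
  apply: le_lt_trans ft; rewrite mulr_ge0 ?(ltW fp)// exprn_ge0// subr_ge0 ler_pdivrMr// mul1r//.
by rewrite leNgt Tt.
Qed.

End profile.

(** * Numerical estimates and first moments *)

Section grunbaum.
Context {R : realType}.
Implicit Types f : R -> R.

(** Take the root of order [d = n.+1] and invert: the claim becomes [1 + 1 / d <= expR (1 / d)]. *)
Lemma expRN1_le (n : nat) : expR (-1) <= (n.+1%:R / n.+2%:R) ^+ n.+1 :> R.
Proof.
have n1 : 0 < n.+1%:R :> R by rewrite ltr0n.
have n2 : 0 < n.+2%:R :> R by rewrite ltr0n.
have -> : -1 = n.+1%:R * (- n.+1%:R^-1) :> R by rewrite mulrN mulfV ?gt_eqF.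
rewrite expRM_natl; apply: lerXn2r; rewrite ?nnegrE ?expR_ge0 ?divr_ge0//.
rewrite expRN -(invrK (n.+1%:R / n.+2%:R)) lef_pV2 ?posrE ?expR_gt0 ?invr_gt0 ?divr_gt0//.
rewrite invf_div; apply: le_trans (expR_ge1Dx _).
by rewrite -(natr1 n.+1) mulrDl divff ?gt_eqF// mul1r.
Qed.

Lemma shift_bound (k : nat) (L h Hp Hm c lam : R) :
  0 < h -> h <= L -> 0 <= Hp -> Hp <= h -> 0 < Hm -> L <= h + Hm -> 0 <= lam <= 1 ->
  c <= h - L * (k.+2%:R / k.+3%:R) ->
  0 <= c + lam * (L ^+ k.+2 / h ^+ k.+1) * (Hp / (k.+3%:R * Hm)) ^+ k.+1 * (1 - 1 / k.+3%:R) ->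
  (1 - lam) * (k.+2%:R / k.+3%:R) <= h / L.
Proof.
move=> h0 hL Hp0 Hph Hm0 LH /andP[l0 l1] cle cge.
have L0 : 0 < L by exact: lt_le_trans hL.
have D0 : 0 < k.+3%:R :> R by rewrite ltr0n.
have DE : k.+2%:R / k.+3%:R = 1 - 1 / k.+3%:R :> R.
  by rewrite -(natr1 k.+2) in D0 *; field; rewrite gt_eqF.
set r : R := 1 - 1 / k.+3%:R in DE cge; rewrite DE in cle *.
have r0 : 0 <= r by rewrite -DE divr_ge0.
have rD : (1 - r) * k.+3%:R = 1 by rewrite /r subKr mul1r mulVf ?gt_eqF.
rewrite ler_pdivlMr//.
(* The center of the cone is at height [h - L * r]. If it is nonnegative, the bound holds even
   without the factor [1 - lam]. *)
have [hr|hr] := leP (L * r) h.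
  apply: le_trans hr; rewrite (mulrC L) ler_wpM2r ?(ltW L0)//.
  by rewrite ler_piMl//; lra.
(* Here [(1 - r) * L < L - h <= Hm], and [1 - r] is [1 / (d + 1)] with [d = k.+2]. *)
have LHm : L <= k.+3%:R * Hm.
  have : (1 - r) * L <= Hm by lra.
  move=> /(ler_wpM2l (ltW D0)); rewrite mulrA (mulrC k.+3%:R) rD mul1r; exact.
have q : (Hp / (k.+3%:R * Hm)) ^+ k.+1 <= (h / L) ^+ k.+1.
  rewrite lerXn2r ?nnegrE ?divr_ge0 ?mulr_ge0 ?(ltW Hm0) ?(ltW h0) ?(ltW L0) ?(ltW D0)//.
  by rewrite ler_pM ?invr_ge0 ?mulr_ge0 ?(ltW Hm0) ?(ltW D0)// lef_pV2 ?posrE ?mulr_gt0.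
have : lam * (L ^+ k.+2 / h ^+ k.+1) * (Hp / (k.+3%:R * Hm)) ^+ k.+1 * r <= lam * L * r.
  rewrite ler_wpM2r// -mulrA ler_wpM2l//.
  apply: (@le_trans _ _ (L ^+ k.+2 / h ^+ k.+1 * (h / L) ^+ k.+1)).
    by rewrite ler_wpM2l// divr_ge0// exprn_ge0// ltW.
  rewrite expr_div_n (exprS L k.+1) le_eqVlt; apply/orP; left; apply/eqP.
  by field; rewrite !expf_neq0 ?gt_eqF.
move=> H; lra.
Qed.

(** Writing [t = h - h * (1 - t / h)] turns the moment into two masses with consecutive
    exponents. *)
Lemma lint_idM_cone (a b h : R) k : h != 0 ->
  lint (fun t => t * cone a b h k t) = h * lint (cone a b h k) - h * lint (cone a b h k.+1).
Proof.
move=> h0; rewrite -mulNr -!lintZ; try exact: nice_cone.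
rewrite -lintD; try exact/niceZ/nice_cone.
congr lint; apply/funext => t; rewrite !coneE; case: ifP => _; last by rewrite !mulr0 addr0.
by rewrite exprS; field.
Qed.

(** A bounded density cannot concentrate its mass at 0: at most half of it fits in [[- e, 0]], and
    the rest lies below [- e]. *)
Lemma mean_lt0 f : nice f -> (forall t, 0 <= f t) -> 0 < lint f ->
  (forall t, 0 < t -> f t = 0) -> lint (fun t => t * f t) < 0.
Proof.
move=> nf f0 V0 ft0; have [_ [C [M fCM]]] := nf.
have fC t : f t <= `|C| + 1.
  have [fC _] := fCM t; have := ler_norm (f t); have := ler_norm C; lra.
pose C' := `|C| + 1; have C'0 : 0 < C' by rewrite ltr_wpDl.
pose e := lint f / (2 * C').
have e0 : 0 < e by rewrite divr_gt0// mulr_gt0.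
have nc := nice_cone (- e) 0 1 0.
have Ic : lint (cone (- e) 0 1 0) = e.
  by rewrite lint_cone ?oppr_le0 ?(ltW e0)// !expr1; lra.
(* With exponent 0, [cone] is the indicator of [[- e, 0]]. The choice of [e] makes the bound
   integrate to [- e * lint f / 2]. *)
apply: (@le_lt_trans _ _ (lint (fun t => (- e) * f t + (e * C') * cone (- e) 0 1 0 t))).
  apply: le_lint.
  - exact: nice_idM.
  - by apply: niceD; exact: niceZ.
  move=> t; rewrite coneE expr0; have [t0|t0] := ltP 0 t.
    by rewrite ft0// !mulr0 add0r; case: ifP => _; rewrite ?mulr0// mulr1 mulr_ge0 ?ltW.
  have := f0 t; have := fC t; rewrite -/C' => fC' ft.
  case: (leP (- e) t) => et /=; last by rewrite mulr0 addr0 ler_wpM2r// ltW.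
  have tf : t * f t <= 0 by rewrite mulr_le0_ge0.
  have := ler_wpM2l (ltW e0) fC'; rewrite mulr1; lra.
rewrite lintD ?lintZ; try exact: niceZ; rewrite ?Ic//.
have -> : e * C' * e = e * (lint f / 2) by rewrite /e; field; rewrite gt_eqF.
have := mulr_gt0 e0 V0; lra.
Qed.

End grunbaum.

(** * The volume bound for one-dimensional profiles *)

Section profile_theorem.
Context {R : realType}.
Implicit Types f : R -> R.

(** Here [d = k.+2], [f] gives slice volumes, [c] is the height of the center of gravity and [P] is
    the set of heights of points of the body. [P] is distinguished from the positivity set of [f]
    because a null slice, such as an apex, still counts for [Hp] and [Hm]. *)
Theorem grunbaum_profile (k : nat) f (P : set R) (Hp Hm c lam : R) :
  nice f -> (forall t, 0 <= f t) -> 0 < f 0 -> root_concave k.+1 f ->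
  (forall y t, P y -> (0 <= t <= y) || (y <= t <= 0) -> f 0 * (1 - t / y) ^+ k.+1 <= f t) ->
  (forall t, 0 < f t -> P t) ->
  0 <= Hp -> (forall y, P y -> y <= Hp) ->
  (forall b, 0 <= b -> (forall y, P y -> y <= b) -> Hp <= b) ->
  (forall y, P y -> - Hm <= y) -> (exists2 y, P y & y < 0) ->
  0 <= lam <= 1 -> lint (fun t => t * f t) = c * lint f ->
  0 <= c + lam * (k.+2%:R * lint f / f 0) * (Hp / (k.+3%:R * Hm)) ^+ k.+1 * (1 - 1 / k.+3%:R) ->
  expR (-1) * (1 - lam) ^+ k.+2 <= lint (fpos f) / lint f.
Proof.
move=> nf f0 fp cf star fP Hp0 PHp Hple PHm [y Py y0] lam01 cV cge.
have V0 : 0 < lint f.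
  by apply: (@mass_gt0 _ k.+1 _ y) => // t ty; apply: star => //; rewrite ty orbT.
have Hm0 : 0 < Hm by rewrite -oppr_lt0; exact: le_lt_trans (PHm _ Py) y0.
have D2 : 0 < k.+2%:R :> R by rewrite ltr0n.
have D3 : 0 < k.+3%:R :> R by rewrite ltr0n.
(* Degenerate case: the shift vanishes with [Hp], so [c >= 0], yet all the mass lies below [W] and
   its mean is negative. *)
have [Hp00|Hpn] := eqVneq Hp 0.
  have c0 : 0 <= c by move: cge; rewrite Hp00 mul0r expr0n/= mulr0 mul0r addr0.
  have : lint (fun t => t * f t) < 0.
    apply: mean_lt0 => // t t0; apply/eqP; rewrite eq_le f0 andbT leNgt.
    by apply/negP => /fP/PHp; rewrite Hp00 leNgt t0.
  by rewrite cV pmulr_llt0// ltNge c0.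
have {Hpn}Hp_gt0 : 0 < Hp by rewrite lt_neqAle eq_sym Hpn.
have low z : P z -> 0 < z -> f 0 * (z / k.+2%:R) <= lint (fpos f).
  by move=> Pz z0; apply: mass_ge_cone_pos => // t tz; apply: star => //; rewrite tz.
have Vp0 : 0 < lint (fpos f).
  have [z Pz z0] : exists2 z, P z & 0 < z.
    apply: contrapT => nz; move: Hp_gt0; rewrite ltNge => /negP; apply.
    by apply: Hple => // z Pz; rewrite leNgt; apply/negP => z0; apply: nz; exists z.
  by apply: lt_le_trans (low _ Pz z0); rewrite mulr_gt0// divr_gt0.
pose h := k.+2%:R * lint (fpos f) / f 0.
have h0 : 0 < h by rewrite divr_gt0// mulr_gt0.
have VpE : lint (fpos f) = f 0 * (h / k.+2%:R).
  by rewrite /h; field; rewrite !gt_eqF.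
clearbody h.
have Ph z : P z -> z <= h.
  move=> Pz; have [z0|z0] := leP z 0; first exact: le_trans z0 (ltW h0).
  by move: (low _ Pz z0); rewrite VpE ler_pM2l// ler_pM2r// invr_gt0.
have Hph : Hp <= h by apply: Hple => //; exact: ltW.
have fh t : 0 < f t -> t <= h by move=> /fP/Ph.
have LE0 : 0 < k.+2%:R * lint f * h ^+ k.+1 / f 0.
  by rewrite divr_gt0// !mulr_gt0// exprn_gt0.
(* Volume of a cone scales as the power [d] of its height; [L] is the height at which the cone with
   apex [h] has the full volume. *)
have [L L0 LE] := exists_root k.+1 LE0.
have VE : lint f = f 0 * (h / k.+2%:R) * (L / h) ^+ k.+2.
  by rewrite expr_div_n LE (exprS h k.+1); field; rewrite ?expf_neq0 ?gt_eqF.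
have nfp := nice_fpos nf; have nfn := nice_fneg nf.
have Vsum := lint_fpos_fneg nf.
have Vn0 : 0 <= lint (fneg f) by apply: lint_ge0 => t; rewrite fnegE; case: ifP.
have hL : h <= L.
  suff : 1 <= L / h by rewrite ler_pdivlMr// mul1r.
  rewrite -(@ler_pXn2r _ k.+2)// ?nnegrE ?ler01 ?divr_ge0 ?(ltW L0) ?(ltW h0)// expr1n.
  rewrite -(@ler_pM2l _ (f 0 * (h / k.+2%:R))) ?mulr_gt0 ?divr_gt0//.
  by rewrite -VE mulr1 -VpE Vsum lerDl.
have hN : h != 0 by rewrite gt_eqF.
have neg t : t < 0 -> f t <= f 0 * (1 - t / h) ^+ k.+1.
  by move=> t0; apply: neg_le_cone => //; rewrite -VpE.
have cone0 x : 0 <= x -> lint (fun t => f 0 * cone (- x) 0 h k.+1 t) =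
    f 0 * (h / k.+2%:R) * (((h + x) / h) ^+ k.+2 - 1).
  move=> x0; rewrite lintZ; last exact: nice_cone.
  rewrite lint_cone ?oppr_le0// mul0r subr0 expr1n mulrA; congr (_ * (_ ^+ _ - _)).
  by field.
have ng a b : nice (fun t => f 0 * cone a b h k.+1 t) by exact/niceZ/nice_cone.
have Vn : lint (fneg f) = f 0 * (h / k.+2%:R) * ((L / h) ^+ k.+2 - 1).
  by rewrite mulrBr -VE mulr1 -VpE Vsum addrC addKr.
(* Below [W] the profile lies under the cone and stops at [- Hm], so its mass is at most that of the
   cone cut at [- Hm]. *)
have LH : L <= h + Hm.
  suff : L / h <= (h + Hm) / h by rewrite ler_pM2r// invr_gt0.
  have hH : 0 <= (h + Hm) / h by rewrite divr_ge0 ?addr_ge0 ?(ltW h0) ?(ltW Hm0).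
  rewrite -(@ler_pXn2r _ k.+2)// ?nnegrE// ?divr_ge0 ?(ltW L0) ?(ltW h0)//.
  rewrite -(lerD2r (-1)) -(@ler_pM2l _ (f 0 * (h / k.+2%:R))) ?mulr_gt0 ?divr_gt0//.
  rewrite -Vn -(cone0 _ (ltW Hm0)); apply: le_lint => // t; rewrite fnegE coneE.
  case: ifP => [t0|_]; last first.
    case: ifP => [/andP[_ t0]|_]; rewrite ?mulr0// mulr_ge0// exprn_ge0// subr_ge0.
    by rewrite (le_trans _ ler01)// pmulr_lle0// invr_gt0.
  have [Ht|Ht] := leP (- Hm) t; first by rewrite (ltW t0)/=; exact: neg.
  rewrite /= mulr0 leNgt; apply/negP => /fP/PHm; by rewrite leNgt Ht.
pose s0 := L - h.
have s00 : 0 <= s0 by rewrite subr_ge0.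
have Lh : h + s0 = L by rewrite /s0; ring.
have mneg : lint (fun t => t * fneg f t) <= lint (fun t => t * (f 0 * cone (- s0) 0 h k.+1 t)).
  (* The crossing is at the base of the cone, [- s0 = h - L]: above it [f] is under the cone, below
     it the cone has ended. *)
  apply: (@moment_compare _ _ _ (- s0)) => //; first by rewrite Vn cone0// Lh.
  move=> t; rewrite fnegE coneE.
  have [t0|t0] := ltP t 0; last first.
    (* At 0 the closed interval of [cone] contributes [f 0] while [fneg] is zero; the sign is still
       right since [- s0 <= 0]. *)
    have [->|tn] := eqVneq t 0.
      by rewrite oppr_le0 s00 lexx/= mul0r !subr0 expr1n mulr1 sub0r mulrNN mulr_ge0// ltW.
    have -> : (- s0 <= t <= 0) = false.
      by apply/negbTE; rewrite negb_and -!ltNge (lt_neqAle 0 t) (eq_sym 0) tn t0 orbT.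
    by rewrite mulr0 subrr mulr0.
  rewrite (ltW t0) andbT; have [st|st] := leP (- s0) t.
    by rewrite mulr_le0// subr_le0//; exact: neg.
  by rewrite mulr0 subr0 mulr_ge0// subr_ge0 ltW.
have [t' cross] := cone_crossing f0 fp cf h0 fh.
have mpos : lint (fun t => t * fpos f t) <= lint (fun t => t * (f 0 * cone 0 h h k.+1 t)).
  apply: (@moment_compare _ _ _ t') => //.
  by rewrite lintZ ?lint_cone_apex ?(ltW h0)//; exact: nice_cone.
have mom : lint (fun t => t * f t) <= h * lint f - lint f * (L * (k.+2%:R / k.+3%:R)).
  have -> : lint (fun t => t * f t) = lint (fun t => t * fpos f t) + lint (fun t => t * fneg f t).
    rewrite -lintD; try exact: nice_idM.
    by congr lint; apply/funext => t; rewrite -mulrDr -fpos_fneg.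
  apply: le_trans (lerD mpos mneg) _.
  have pull a b : lint (fun t => t * (f 0 * cone a b h k.+1 t)) =
      f 0 * lint (fun t => t * cone a b h k.+1 t).
    rewrite -lintZ; last exact/nice_idM/nice_cone.
    by congr lint; apply/funext => t; rewrite mulrCA.
  rewrite !pull !lint_idM_cone// !lint_cone ?oppr_le0 ?(ltW h0)// !mul0r !subr0 divff// subrr.
  rewrite mulNr opprK (_ : 1 + s0 / h = L / h); last by rewrite -Lh; field.
  rewrite !expr1n !expr0n/= VE !subr0 (exprS _ k.+2).
  rewrite le_eqVlt; apply/orP; left; apply/eqP.
  set X := (L / h) ^+ k.+2.
  by field; rewrite !gt_eqF.
have cle : c <= h - L * (k.+2%:R / k.+3%:R).
  rewrite -(@ler_pM2r _ (lint f))// -cV; apply: le_trans mom _.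
  by rewrite mulrBl [X in _ <= _ - X]mulrC.
have dV : k.+2%:R * lint f / f 0 = L ^+ k.+2 / h ^+ k.+1.
  by rewrite LE; field; rewrite ?expf_neq0 ?gt_eqF.
rewrite dV in cge.
have key := shift_bound h0 hL Hp0 Hph Hm0 LH lam01 cle cge.
have -> : lint (fpos f) / lint f = (h / L) ^+ k.+2.
  rewrite VpE VE !expr_div_n; field.
  by rewrite ?expf_neq0 ?gt_eqF.
case/andP: lam01 => l0 l1.
apply: (@le_trans _ _ ((k.+2%:R / k.+3%:R) ^+ k.+2 * (1 - lam) ^+ k.+2)).
  by rewrite ler_wpM2r ?exprn_ge0 ?subr_ge0//; exact: expRN1_le.
rewrite -exprMn lerXn2r ?nnegrE ?divr_ge0 ?(ltW L0) ?(ltW h0)//.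
  by rewrite mulr_ge0 ?divr_ge0 ?subr_ge0.
by rewrite mulrC.
Qed.

End profile_theorem.

(** * Signed iterated integrals *)

Section signed_iint.
Context {R : realType}.
Local Notation mu := (@lebesgue_measure R).
Local Notation RT := (measurableTypeR R).

Definition riint n (u : 'rV[R]_n -> R) : R := fine (iint (fun z => (u z)%:E)).

(* Signed integrands are handled as differences of nonnegative bounded ones. *)
Definition rvnice n (M : R) (u : 'rV[R]_n -> R) := exists p q C, [/\ 0 <= C,
  rvmeas (fun z => (p z)%:E) /\ boxed C M (fun z => (p z)%:E),
  rvmeas (fun z => (q z)%:E) /\ boxed C M (fun z => (q z)%:E) & forall z, u z = p z - q z].

Lemma riint_boxed n (C M : R) (p : 'rV[R]_n -> R) : 0 <= C -> 0 <= M ->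
  rvmeas (fun z => (p z)%:E) -> boxed C M (fun z => (p z)%:E) ->
  iint (fun z => (p z)%:E) = (riint p)%:E.
Proof.
move=> C0 M0 mp bp; rewrite fineK// ge0_fin_numE; last first.
  by apply: iint_ge0 => z; have [] := bp z.
exact: le_lt_trans (iint_boxed C0 M0 mp bp) (ltry _).
Qed.

Lemma iint_sub n (C M : R) (u p q : 'rV[R]_n -> R) : 0 <= C -> 0 <= M ->
  rvmeas (fun z => (p z)%:E) -> boxed C M (fun z => (p z)%:E) ->
  rvmeas (fun z => (q z)%:E) -> boxed C M (fun z => (q z)%:E) ->
  (forall z, u z = p z - q z) ->
  iint (fun z => (u z)%:E) = (riint p - riint q)%:E.
Proof.
move=> C0 M0 mp bp mq bq upq; under eq_iint => z do rewrite upq EFinB.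
by rewrite (iintB C0 M0 mp bp mq bq) (riint_boxed C0 M0 mp bp) (riint_boxed C0 M0 mq bq).
Qed.

Lemma iint_rvnice n (M : R) (u : 'rV[R]_n -> R) : 0 <= M -> rvnice M u ->
  iint (fun z => (u z)%:E) = (riint u)%:E.
Proof.
move=> M0 [p [q [C [C0 [mp bp] [mq bq] upq]]]].
by rewrite /riint (iint_sub C0 M0 mp bp mq bq upq).
Qed.

Lemma boxedD n (C C' M : R) (p q : 'rV[R]_n -> R) : boxed C M (fun z => (p z)%:E) ->
  boxed C' M (fun z => (q z)%:E) -> boxed (C + C') M (fun z => (p z + q z)%:E).
Proof.
move=> bp bq z; have := bp z; have := bq z; rewrite !lee_fin => -[q0 qC] [p0 pC].
by rewrite addr_ge0//; split => //; rewrite mulrDl lerD.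
Qed.

Lemma rvmeasD n (p q : 'rV[R]_n -> R) : rvmeas (fun z => (p z)%:E) ->
  rvmeas (fun z => (q z)%:E) -> rvmeas (fun z => (p z + q z)%:E).
Proof.
move=> mp mq d T g mg; apply/measurable_EFinP.
by apply: measurable_funD; apply/measurable_EFinP; [exact: mp|exact: mq].
Qed.

Lemma rvmeasM n (p q : 'rV[R]_n -> R) : rvmeas (fun z => (p z)%:E) ->
  rvmeas (fun z => (q z)%:E) -> rvmeas (fun z => (p z * q z)%:E).
Proof.
move=> mp mq d T g mg; apply/measurable_EFinP.
by apply: measurable_funM; apply/measurable_EFinP; [exact: mp|exact: mq].
Qed.

Lemma rvmeas_cst n (c : R) : rvmeas (fun _ : 'rV[R]_n => c%:E).
Proof. by move=> d T g mg; exact: measurable_cst. Qed.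

Lemma rvmeas_coord n (i : 'I_n) : rvmeas (fun z : 'rV[R]_n => (z 0 i)%:E).
Proof. by move=> d T g mg; apply/measurable_EFinP; exact: mg. Qed.

Lemma riintD_ge0 n (C C' M : R) (p q : 'rV[R]_n -> R) : 0 <= C -> 0 <= C' -> 0 <= M ->
  rvmeas (fun z => (p z)%:E) -> boxed C M (fun z => (p z)%:E) ->
  rvmeas (fun z => (q z)%:E) -> boxed C' M (fun z => (q z)%:E) ->
  riint (fun z => p z + q z) = riint p + riint q.
Proof.
move=> C0 C'0 M0 mp bp mq bq; rewrite {1}/riint.
under eq_iint => z do rewrite EFinD.
rewrite iintD//; try by move=> z; have [] := bp z.
- by rewrite (riint_boxed C0 M0 mp bp) (riint_boxed C'0 M0 mq bq).
- by move=> z; have [] := bq z.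
Qed.

Lemma rvniceD n (M : R) (u v : 'rV[R]_n -> R) : 0 <= M -> rvnice M u -> rvnice M v ->
  rvnice M (fun z => u z + v z) /\ riint (fun z => u z + v z) = riint u + riint v.
Proof.
move=> M0 [p [q [C [C0 [mp bp] [mq bq] upq]]]] [p' [q' [C' [C'0 [mp' bp'] [mq' bq'] vpq]]]].
have CC0 : 0 <= C + C' by rewrite addr_ge0.
have mP := rvmeasD mp mp'; have mQ := rvmeasD mq mq'.
have bP := boxedD bp bp'; have bQ := boxedD bq bq'.
have uv z : u z + v z = (p z + p' z) - (q z + q' z) by rewrite upq vpq; ring.
split; first by exists (fun z => p z + p' z), (fun z => q z + q' z), (C + C'); split.
rewrite /riint (iint_sub CC0 M0 mP bP mQ bQ uv) (iint_sub C0 M0 mp bp mq bq upq).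
rewrite (iint_sub C'0 M0 mp' bp' mq' bq' vpq) /=.
rewrite (riintD_ge0 C0 C'0 M0 mp bp mp' bp') (riintD_ge0 C0 C'0 M0 mq bq mq' bq'); ring.
Qed.

Lemma rvniceN n (M : R) (u : 'rV[R]_n -> R) : 0 <= M -> rvnice M u ->
  rvnice M (fun z => - u z) /\ riint (fun z => - u z) = - riint u.
Proof.
move=> M0 [p [q [C [C0 [mp bp] [mq bq] upq]]]].
have uN z : - u z = q z - p z by rewrite upq opprB.
split; first by exists q, p, C; split.
rewrite /riint (iint_sub C0 M0 mp bp mq bq upq) (iint_sub C0 M0 mq bq mp bp uN) /=.
by rewrite opprB.
Qed.

Lemma rvniceZ n (M c : R) (u : 'rV[R]_n -> R) : 0 <= M -> rvnice M u ->
  rvnice M (fun z => c * u z) /\ riint (fun z => c * u z) = c * riint u.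
Proof.
move=> M0; have pos (a : R) w : 0 <= a -> rvnice M w ->
    rvnice M (fun z : 'rV[R]_n => a * w z) /\ riint (fun z => a * w z) = a * riint w.
  move=> a0 [p [q [C [C0 [mp bp] [mq bq] wpq]]]].
  have aC0 : 0 <= a * C by rewrite mulr_ge0.
  have ok r : rvmeas (fun z => (r z)%:E) -> boxed C M (fun z => (r z)%:E) ->
      [/\ rvmeas (fun z : 'rV[R]_n => (a * r z)%:E), boxed (a * C) M (fun z => (a * r z)%:E)
       & riint (fun z => a * r z) = a * riint r].
    move=> mr br; split.
    - exact: (rvmeasM (rvmeas_cst a) mr).
    - move=> z; have := br z; rewrite !lee_fin => -[r0 rC]; rewrite mulr_ge0//; split => //.
      by rewrite -mulrA ler_wpM2l.
    - rewrite /riint; under eq_iint => z do rewrite EFinM.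
      rewrite iintZl//; last by move=> z; have [] := br z.
      by rewrite (riint_boxed C0 M0 mr br).
  have [maP baP aP] := ok p mp bp; have [maQ baQ aQ] := ok q mq bq.
  have awE z : a * w z = a * p z - a * q z by rewrite wpq mulrBr.
  split; first by exists (fun z => a * p z), (fun z => a * q z), (a * C); split.
  rewrite /riint (iint_sub aC0 M0 maP baP maQ baQ awE) (iint_sub C0 M0 mp bp mq bq wpq) /=.
  by rewrite aP aQ mulrBr.
move=> nu; have [c0|c0] := leP 0 c; first exact: pos.
have nc0 : 0 <= - c by rewrite oppr_ge0 ltW.
have [n1 e1] := pos _ _ nc0 nu; have [n2 e2] := rvniceN M0 n1.
have e : (fun z => - (- c * u z)) = (fun z => c * u z).
  by apply/funext => z; rewrite mulNr opprK.
by rewrite e in n2 e2; split => //; rewrite e2 e1 mulNr opprK.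
Qed.

Lemma rvnice_sum n (M : R) (I : Type) (r : seq I) (u : I -> 'rV[R]_n -> R) : 0 <= M ->
  (forall i, rvnice M (u i)) ->
  rvnice M (fun z => \sum_(i <- r) u i z) /\
  riint (fun z => \sum_(i <- r) u i z) = \sum_(i <- r) riint (u i).
Proof.
move=> M0 nu; elim: r => [|i r [IH1 IH2]].
  have e : (fun z : 'rV[R]_n => \sum_(i <- [::]) u i z) = fun=> 0.
    by apply/funext => z; rewrite big_nil.
  have n0 : rvnice M (fun _ : 'rV[R]_n => 0).
    exists (fun=> 0), (fun=> 0), 0; split=> //; try by rewrite subrr.
    - by split; [exact: rvmeas_cst|move=> z; rewrite mul0r].
    - by split; [exact: rvmeas_cst|move=> z; rewrite mul0r].
  rewrite e big_nil; split => //.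
  by have [_] := rvniceZ 0 M0 n0; rewrite [RHS]mul0r !mulr0.
have [n1 e1] := rvniceD M0 (nu i) IH1.
have e : (fun z => \sum_(i <- i :: r) u i z) = (fun z => u i z + \sum_(i <- r) u i z).
  by apply/funext => z; rewrite big_cons.
by rewrite e big_cons e1 IH2.
Qed.

(** Linear maps do not carry cubes to cubes; [M'] is a radius for the preimage of the cube of radius
    [M]. *)
Lemma riint_mulmx n (M M' : R) (A : 'M[R]_n) (u : 'rV[R]_n -> R) : 0 <= M -> 0 <= M' ->
  `|\det A| = 1 -> (forall w : 'rV[R]_n, box M (w *m A) -> box M' w) -> rvnice M u ->
  riint (fun w => u (w *m A)) = riint u.
Proof.
move=> M0 M'0 dA MA [p [q [C [C0 [mp bp] [mq bq] upq]]]].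
have dA0 : \det A != 0 by rewrite -normr_gt0 dA.
have ok r : rvmeas (fun z => (r z)%:E) -> boxed C M (fun z => (r z)%:E) ->
    [/\ rvmeas (fun w => (r (w *m A))%:E), boxed C M' (fun w => (r (w *m A))%:E)
      & riint (fun w => r (w *m A)) = riint r].
  move=> mr br; split.
  - exact: (rvmeas_mulmx A mr).
  - move=> w; have [r0 rC] := br (w *m A); split => //.
    apply: le_trans rC _; rewrite lee_fin ler_wpM2l// !indicE ler_nat.
    by case: (boolP (_ \in _)) => // /set_mem/MA h; rewrite (mem_set h).
  - rewrite /riint -[in RHS](iint_mulmx dA0 mr); last by move=> z; have [] := br z.
    by rewrite dA mul1e.
have [mP bP eP] := ok p mp bp; have [mQ bQ eQ] := ok q mq bq.
have uA w : u (w *m A) = p (w *m A) - q (w *m A) by exact: upq.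
rewrite /riint (iint_sub C0 M'0 mP bP mQ bQ uA) (iint_sub C0 M0 mp bp mq bq upq) /=.
by rewrite eP eQ.
Qed.

Lemma rvnice_indic n (M : R) (A : set 'rV[R]_n) : rvmset A -> A `<=` box M -> rvnice M \1_A.
Proof.
move=> mA AM; exists \1_A, (fun=> 0), 1; split=> //; last by move=> z; rewrite subr0.
- by split=> //; exact: boxed_indic.
- by split; [exact: rvmeas_cst|move=> z; rewrite !lee_fin mul1r indicE; split].
Qed.

Lemma rvnice_coord n (M : R) (A : set 'rV[R]_n) (i : 'I_n) : 0 <= M -> rvmset A ->
  A `<=` box M -> rvnice M (fun z => z 0 i * \1_A z).
Proof.
move=> M0 mA AM.
(* Adding [M] makes the coordinate nonnegative on the cube, and the second function takes it away
   again. *)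
exists (fun z : 'rV[R]_n => (z 0 i + M) * \1_A z), (fun z => M * \1_A z), (2 * M); split.
- by rewrite mulr_ge0.
- split; first exact: (rvmeasM (rvmeasD (rvmeas_coord i) (rvmeas_cst M)) mA).
  move=> z; rewrite !lee_fin !indicE; case: (boolP (z \in A)) => [/set_mem/AM zM|_].
    have := zM i; rewrite ler_norml (mem_set zM) !mulr1 => /andP[h1 h2]; split; lra.
  by rewrite mulr0; split => //; rewrite mulr_ge0// mulr_ge0.
- split; first exact: (rvmeasM (rvmeas_cst M) mA).
  move=> z; rewrite !lee_fin !indicE; case: (boolP (z \in A)) => [/set_mem/AM zM|_].
    by rewrite (mem_set zM) !mulr1; split; lra.
  by rewrite mulr0; split => //; rewrite mulr_ge0// mulr_ge0.
- by move=> z; ring.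
Qed.

Lemma riint_first_coord n (M : R) (A : set 'rV[R]_n.+1) : 0 <= M -> rvmset A -> A `<=` box M ->
  riint (fun z => z 0 0 * \1_A z) = lint (fun t => t * slice_vol A t).
Proof.
move=> M0 mA AM; rewrite /riint /lint /Rintegral /=; congr fine; apply: eq_integral => x _.
have ns : rvnice M \1_(slice A x).
  by apply: rvnice_indic; [exact: rvmset_slice|exact: slice_box].
have [nz ez] := rvniceZ x M0 ns.
rewrite -[slice_vol A x]/(riint \1_(slice A x)) -ez -(iint_rvnice M0 nz).
apply: eq_iint => t; congr (_ * _)%:E.
have -> : (0 : 'I_n.+1) = @lshift 1 n 0 by exact: val_inj.
by rewrite (@row_mxEl _ 1 1 n) mxE eqxx mulr1n.
Qed.

End signed_iint.

(** * Slices of a rotated convex body *)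

Section convex_slices.
Context {R : realType}.
Local Notation RT := (measurableTypeR R).

Definition convex_rv n (A : set 'rV[R]_n) :=
  forall a b (t : R), A a -> A b -> 0 <= t <= 1 -> A ((1 - t) *: a + t *: b).

Lemma nice_slice_vol n (M : R) (A : set 'rV[R]_n.+1) : 0 <= M -> rvmset A -> A `<=` box M ->
  nice (slice_vol A).
Proof.
move=> M0 mA AM; split; first exact: (measurable_slice_vol M0 mA AM).
exists ((2 * M) ^+ n), M => x; split.
  rewrite ger0_norm ?vol_ge0//; apply: vol_box => //.
  - exact: rvmset_slice.
  - exact: slice_box.
by move=> x0; rewrite ler_norml; apply: (slice_vol_supp AM); rewrite lt_neqAle eq_sym x0 vol_ge0.
Qed.

Lemma slice_convex n (A : set 'rV[R]_n.+1) (s x y : R) t u : convex_rv A -> 0 <= s <= 1 ->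
  slice A x t -> slice A y u -> slice A ((1 - s) * x + s * y) ((1 - s) *: t + s *: u).
Proof.
by move=> cA s01 At Au; rewrite /slice/= -scale_row_mx_comb; exact: cA.
Qed.

Lemma slice_vol_root_concave n (M : R) (A : set 'rV[R]_n.+2) : 0 <= M -> rvmset A ->
  A `<=` box M -> convex_rv A -> root_concave n.+1 (slice_vol A).
Proof.
move=> M0 mA AM cA s x y a b s01 a0 b0 ax bY.
apply: (@brunn_minkowski _ n (slice A x) (slice A y) _ s M) => //;
  try exact: rvmset_slice; try exact: slice_box.
by move=> t u; apply: slice_convex => //; case/andP: s01 => /ltW -> /ltW ->.
Qed.

(** For [b] in the slice at [y] and [s = t / y], convexity puts the copy of the slice at 0 scaled by
    [1 - s] and translated by [s *: b] inside the slice at [t]. *)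
Lemma slice_vol_ge_cone n (M : R) (A : set 'rV[R]_n.+1) (y t : R) : 0 <= M -> rvmset A ->
  A `<=` box M -> convex_rv A -> slice A y !=set0 ->
  (0 <= t <= y) || (y <= t <= 0) ->
  (0 < n)%N -> slice_vol A 0 * (1 - t / y) ^+ n <= slice_vol A t.
Proof.
move=> M0 mA AM cA [b Ab] ty n0.
(* Then [t = 0], and [t / y] is 0 by convention, so both sides coincide. *)
have [y0|yn] := eqVneq y 0.
  have -> : t = 0 by case/orP: ty; rewrite y0 => h; apply/eqP; rewrite eq_le andbC.
  by rewrite mul0r subr0 expr1n mulr1.
pose s := t / y.
have s01 : 0 <= s <= 1.
  rewrite /s; case/orP: ty => /andP[h1 h2].
    have yp : 0 < y by rewrite lt_neqAle eq_sym yn (le_trans h1).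
    by rewrite divr_ge0 ?(ltW yp)//= ler_pdivrMr// mul1r.
  have yp : y < 0 by rewrite lt_neqAle yn (le_trans h1).
  by rewrite mulr_le0 ?invr_le0 ?(ltW yp)//= ler_ndivrMr// mul1r.
(* At [s = 1] the scaling is singular; the left side is zero because [n] is positive. *)
rewrite -/s; have [s1|s1] := eqVneq s 1.
  by rewrite s1 subrr expr0n (gtn_eqF n0) mulr0 vol_ge0.
have c0 : 0 < 1 - s by case/andP: s01 => _; rewrite subr_gt0 lt_neqAle s1.
have mS : rvmset (slice A t) by exact: rvmset_slice.
have mS0 : rvmset (slice A 0) by exact: rvmset_slice.
have SM : slice A t `<=` box M by exact: slice_box.
have S0M : slice A 0 `<=` box M by exact: slice_box.
have dA : \det ((1 - s)%:M : 'M[R]_n) = (1 - s) ^+ n by rewrite det_scalar.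
have dA0 : \det ((1 - s)%:M : 'M[R]_n) != 0 by rewrite dA expf_neq0// gt_eqF.
rewrite -lee_fin /slice_vol -(iint_vol M0 mS SM).
have mT : rvmeas (fun z => (\1_(slice A t) (z + s *: b))%:E).
  move=> d T g mg; apply: (mS d T (fun x => g x + s *: b)) => i.
  under eq_fun do rewrite !mxE.
  by apply: measurable_funD => //; exact: mg.
rewrite -(iint_translate (s *: b) mS); last by move=> z; rewrite lee_fin.
rewrite -(iint_mulmx dA0 mT); last by move=> z; rewrite lee_fin.
rewrite dA ger0_norm ?exprn_ge0 ?(ltW c0)// mulrC EFinM -(iint_vol M0 mS0 S0M).
rewrite lee_wpmul2l ?lee_fin ?exprn_ge0 ?(ltW c0)//; apply: le_iint => //.
- exact: (rvmeas_mulmx _ mT).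
move=> z; rewrite lee_fin !indicE ler_nat; case: (boolP (z \in slice A 0)) => // /set_mem zA.
rewrite mem_set//; have := slice_convex cA s01 zA Ab.
by rewrite mulr0 add0r /s divfK// mul_mx_scalar.
Qed.

End convex_slices.

Lemma dotvC (R : realType) n (u w : 'rV[R]_n) : dotv u w = dotv w u.
Proof. by rewrite /dotv -[in LHS](trmxK (u *m w^T)) trmx_mul trmxK mxE. Qed.

Lemma dotv_linear (R : realType) n (u x y : 'rV[R]_n) (c : R) :
  dotv u (x + c *: y) = dotv u x + c * dotv u y.
Proof.
rewrite /dotv !mxE mulr_sumr -big_split; apply: eq_bigr => i _ /=.
by rewrite !mxE; ring.
Qed.

Lemma hyp_embedE (R : realType) n (y : 'rV[R]_n) :
  @hyp_embed R n.+1 y = row_mx (0%:M : 'rV[R]_1) y.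
Proof.
apply/rowP => i; rewrite [LHS]mxE; case: (@splitP 1 n i) => j ij.
  have -> : i = lshift n j by apply/val_inj.
  by rewrite (@row_mxEl _ 1 1 n) ord1/= mxE mul0rn.
have -> : i = rshift 1 j by apply/val_inj.
rewrite (@row_mxEr _ 1 1 n)/= add0n (nth_map j) ?size_enum_ord//.
by congr (y _ _); apply/val_inj; rewrite /= nth_enum_ord.
Qed.

(** * Orthogonal changes of coordinates *)

Section rotated_body.
Context {R : realType} {n : nat}.
Implicit Types (Q : 'M[R]_n.+1) (v w : 'rV[R]_n.+1).

Lemma orthogonal_trmxK Q (oQ : orthogonal_mx Q) w : w *m Q^T *m Q = w.
Proof. by rewrite -mulmxA (mulmx1C oQ) mulmx1. Qed.

Lemma orthogonal_mulmxK Q (oQ : orthogonal_mx Q) w : w *m Q *m Q^T = w.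
Proof. by rewrite -mulmxA oQ mulmx1. Qed.

Lemma orthogonal_det Q (oQ : orthogonal_mx Q) : `|\det Q| = 1.
Proof.
have := congr1 determinant oQ; rewrite det_mulmx det_tr det1 -expr2 => dQ.
by apply/eqP; rewrite -sqrp_eq1// -normrX dQ normr1.
Qed.

Lemma dotv_rotate Q v (oQ : orthogonal_mx Q) (Qv : row 0 Q = v) w : dotv v (w *m Q) = w 0 0.
Proof.
rewrite /dotv trmx_mul mulmxA -Qv -row_mul oQ -row_mul mul1mx.
by rewrite !mxE.
Qed.

Lemma box_rotate Q (oQ : orthogonal_mx Q) (M : R) : 0 <= M -> exists2 M', 0 <= M' &
  forall w : 'rV[R]_n.+1, box M (w *m Q) -> box M' w.
Proof.
move=> M0; pose S := \sum_i \sum_j `|Q i j|.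
have S0 : 0 <= S by apply: sumr_ge0 => i _; apply: sumr_ge0.
exists (M * (1 + S)); first by rewrite mulr_ge0// addr_ge0.
move=> w wM i; rewrite -(orthogonal_mulmxK oQ w) mxE.
apply: le_trans (ler_norm_sum _ _ _) _.
apply: (@le_trans _ _ (\sum_j M * `|Q i j|)).
  by apply: ler_sum => j _; rewrite normrM [Q^T _ _]mxE ler_wpM2r.
rewrite -mulr_sumr ler_wpM2l// ler_wpDl// /S [leRHS](bigD1 i)//= lerDl.
by apply: sumr_ge0 => k _; exact: sumr_ge0.
Qed.

Lemma vol_rotate Q (oQ : orthogonal_mx Q) (K : set 'rV[R]_n.+1) : rvmset K ->
  vol [set w | K (w *m Q)] = vol K.
Proof.
move=> mK; have dQ : \det Q != 0 by rewrite -normr_gt0 (orthogonal_det oQ).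
rewrite /vol -[in RHS](iint_mulmx dQ mK); last by move=> z; rewrite lee_fin.
by rewrite (orthogonal_det oQ) mul1e.
Qed.

End rotated_body.

(** [cg] is defined coordinate by coordinate, so its pairing with [v] is a finite sum equal to the
    integral of [dotv v z] over [K], up to the factor [vol K]; the rotation turns this functional
    into the first coordinate. *)
Lemma moment_rotate (R : realType) n (Q : 'M[R]_n.+1) (v : 'rV[R]_n.+1) (K : set 'rV[R]_n.+1)
    (M : R) : orthogonal_mx Q -> row 0 Q = v -> 0 <= M -> rvmset K -> K `<=` box M ->
  vol K != 0 ->
  lint (fun t => t * slice_vol [set w | K (w *m Q)] t) = dotv v (cg K) * vol K.
Proof.
move=> oQ Qv M0 mK KM V0.
have [M' M'0 QM] := box_rotate oQ M0.
have mK' : rvmset [set w | K (w *m Q)] by exact: (rvmeas_mulmx Q mK).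
rewrite -(@riint_first_coord _ _ M')//; last by move=> w /KM/QM.
pose u (i : 'I_n.+1) (z : 'rV[R]_n.+1) : R := v 0 i * (z 0 i * \1_K z).
have nc i : rvnice M (fun z : 'rV[R]_n.+1 => z 0 i * \1_K z) by exact: rvnice_coord.
have nu i : rvnice M (u i) by have [] := rvniceZ (v 0 i) M0 (nc i).
have [ns es] := rvnice_sum (index_enum _) M0 nu.
have uE z : \sum_i u i z = dotv v z * \1_K z.
  rewrite /dotv mxE mulr_suml; apply: eq_bigr => i _.
  by rewrite /u mulrA [z^T _ _]mxE.
transitivity (riint (fun z => \sum_i u i z)).
  rewrite -(riint_mulmx M0 M'0 (orthogonal_det oQ) QM ns).
  by congr riint; apply/funext => w; rewrite uE (dotv_rotate oQ Qv).
rewrite es /dotv mxE mulr_suml; apply: eq_bigr => i _.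
have [_ ->] := rvniceZ (v 0 i) M0 (nc i).
by rewrite !mxE -mulrA divfK.
Qed.

Theorem theorem2 (R : realType) (d : nat) (hd : (2 <= d)%N)
  (K : set 'rV[R]_d) (v : 'rV[R]_d) (Q : 'M[R]_d) (lambda : R) :
  convex_body K ->
  enorm v = 1 ->
  orthogonal_mx Q -> (forall i0 : 'I_d, (i0 : nat) = 0%N -> row i0 Q = v) ->
  let Kp := K `&` [set w | 0 <= dotv v w] in
  let Km := K `&` [set w | dotv v w < 0] in
  Kp !=set0 -> Km !=set0 ->
  0 < section_area Q K ->
  let HKp := sup [set dotv a v | a in Kp] in
  let HKm := sup [set - dotv a v | a in Km] in
  (* omega_{d-1} R^{d-1} = V_{d-1}(K ∩ W) by definition of R *)
  0 <= lambda <= 1 ->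
  let Lambda := lambda * (d%:R * vol K / section_area Q K)
                 * (HKp / ((d.+1)%:R * HKm)) ^+ d.-1
                 * (1 - 1 / (d.+1)%:R) in
  Kp (cg K + Lambda *: v) ->
  vol Kp / vol K >= expR (-1) * (1 - lambda) ^+ d.
Proof.
case: d hd K v Q => [//|[//|k]] _ K v Q [Kc Kconv _] v1 oQ Qv0.
move=> Kp Km [ap Kpa] [am Kma] A0 HKp HKm lam01 Lambda Kcg.
have Qv : row 0 Q = v by exact: Qv0.
have [M M0' KM] := compact_box Kc; have M0 := ltW M0'.
have [M' M'0 QM] := box_rotate oQ M0.
have mK : rvmset K by apply: closed_rvmset; exact: compact_closed.
(* [K] in coordinates where the first axis is [v]: heights above [W] become first coordinates, and
   the section by [W] is the slice at 0. *)
pose K' : set 'rV[R]_k.+2 := [set w | K (w *m Q)].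
have mK' : rvmset K' by exact: (rvmeas_mulmx Q mK).
have K'M : K' `<=` box M' by move=> w /KM/QM.
have cK' : convex_rv K'.
  by move=> a b t Ka Kb t01; rewrite /K'/= mulmxDl -!scalemxAl; exact: Kconv.
pose f := slice_vol K'.
have nf : nice f by exact: (nice_slice_vol M'0 mK' K'M).
have dotE (w : 'rV[R]_k.+2) : dotv v (w *m Q) = w 0 0 by exact: dotv_rotate.
have split_pt a : K a -> slice K' (dotv v a) !=set0.
  move=> Ka; pose w := a *m Q^T; have aE : w *m Q = a by rewrite orthogonal_trmxK.
  have -> : dotv v a = w 0 0 by rewrite -aE dotE.
  by exists (@rsubmx R 1 1 k.+1 w); rewrite /slice/= -row_mx_split /K'/= aE.
have from_slice y : slice K' y !=set0 -> exists2 a, K a & dotv v a = y.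
  move=> [t Kt]; exists ((row_mx (y%:M : 'rV[R]_1) t : 'rV[R]_k.+2) *m Q) => //.
  rewrite dotE.
  have -> : (0 : 'I_k.+2) = @lshift 1 k.+1 0 by exact: val_inj.
  by rewrite (@row_mxEl _ 1 1 k.+1) mxE eqxx mulr1n.
have Aarea : section_area Q K = f 0.
  rewrite /section_area /f /slice_vol; congr vol; apply/seteqP.
  by split => y /=; rewrite hyp_embedE.
have dotM a : K a -> `|dotv v a| <= M'.
  by move=> /split_pt[t h]; rewrite ler_norml; exact: (slice_supp K'M h).
have hsp : has_sup [set dotv a v | a in Kp].
  split; first by exists (dotv ap v), ap.
  by exists M' => _ [a [Ka _] <-]; rewrite dotvC; exact: le_trans (ler_norm _) (dotM _ Ka).
have hsm : has_sup [set - dotv a v | a in Km].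
  split; first by exists (- dotv am v), am.
  exists M' => _ [a [Ka _] <-]; rewrite dotvC; apply: le_trans (dotM _ Ka).
  by rewrite -normrN; exact: ler_norm.
have leHp a : Kp a -> dotv v a <= HKp.
  by move=> Ka; apply: ub_le_sup; [case: hsp|exists a; rewrite // dotvC].
have leHm a : Km a -> - dotv v a <= HKm.
  by move=> Ka; apply: ub_le_sup; [case: hsm|exists a; rewrite // dotvC].
have Hp0 : 0 <= HKp by apply: le_trans (leHp _ Kpa); case: Kpa.
have Hm0 : 0 < HKm by apply: lt_le_trans (leHm _ Kma); rewrite oppr_gt0; case: Kma.
have VE : lint f = vol K.
  rewrite -(vol_rotate oQ mK) -[RHS]/(fine (vol K')%:E) -(int_slice_vol M'0 mK' K'M).
  by [].
have mH : rvmset [set w : 'rV[R]_k.+2 | 0 <= w 0 0].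
  apply/rvmsetP => d T g mg; rewrite -[X in measurable X]setTI.
  have := mg 0 measurableT `[0, +oo[%classic (measurable_itv _).
  rewrite (_ : _ @^-1` `[0, +oo[ = g @^-1` [set w | 0 <= w 0 0])//.
  by apply/seteqP; split => t /=; rewrite in_itv/= andbT.
have mKp : rvmset Kp.
  have -> : Kp = [set z | (K' `&` [set w : 'rV[R]_k.+2 | 0 <= w 0 0]) (z *m Q^T)].
    apply/seteqP; split => z /=; rewrite /Kp /K' /= -(dotE (z *m Q^T)) orthogonal_trmxK//.
  exact: (rvmeas_mulmx Q^T (rvmsetI mK' mH)).
have VpE : lint (fpos f) = vol Kp.
  have KpE : [set w | Kp (w *m Q)] = K' `&` [set w : 'rV[R]_k.+2 | 0 <= w 0 0].
    by apply/seteqP; split => w /=; rewrite /Kp /= dotE.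
  have mKp' : rvmset [set w | Kp (w *m Q)] by exact: (rvmeas_mulmx Q mKp).
  have Kp'M : [set w | Kp (w *m Q)] `<=` box M' by move=> w [/KM/QM].
  rewrite -(vol_rotate oQ mKp) -[RHS]/(fine (vol [set w | Kp (w *m Q)])%:E).
  rewrite -(int_slice_vol M'0 mKp' Kp'M) -/(lint _); congr lint; apply/funext => t.
  rewrite fposE KpE /f /slice_vol.
  have t00 (u : 'rV[R]_k.+1) : (row_mx (t%:M : 'rV[R]_1) u : 'rV[R]_k.+2) 0 0 = t.
    have -> : (0 : 'I_k.+2) = @lshift 1 k.+1 0 by exact: val_inj.
    by rewrite (@row_mxEl _ 1 1 k.+1) mxE eqxx mulr1n.
  case: ifP => t0.
    by congr vol; apply/seteqP; split => u /=; rewrite /slice/= t00 t0 => // -[].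
  rewrite [slice _ _](_ : _ = set0) ?vol_set0//.
  by apply/seteqP; split => u //=; rewrite /slice/= t00 t0 => -[].
have f0 : 0 < f 0 by rewrite -Aarea.
have [yn Pyn yn0] : exists2 y, slice K' y !=set0 & y < 0.
  by exists (dotv v am); [apply: split_pt|]; case: Kma.
have star y t : slice K' y !=set0 -> (0 <= t <= y) || (y <= t <= 0) ->
    f 0 * (1 - t / y) ^+ k.+1 <= f t.
  by move=> Py ty; apply: (slice_vol_ge_cone M'0 mK' K'M cK' Py ty).
have V0 : 0 < lint f.
  by apply: (mass_gt0 nf (fun t => vol_ge0 _) f0 yn0) => t ty; apply: star => //; rewrite ty orbT.
rewrite -VpE -VE.
apply: (@grunbaum_profile _ _ f [set y | slice K' y !=set0] HKp HKm (dotv v (cg K))) => //.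
- by move=> t; exact: vol_ge0.
- exact: (slice_vol_root_concave M'0 mK' K'M cK').
- by move=> t; exact: slice_vol_nonempty.
- move=> y /from_slice[a Ka <-]; have [a0|a0] := leP 0 (dotv v a); first exact: leHp.
  exact: le_trans (ltW a0) Hp0.
- move=> b b0 Pb; apply: ge_sup; first by exists (dotv ap v), ap.
  by move=> _ [a [Ka _] <-]; rewrite dotvC; apply: Pb; exact: split_pt.
- move=> y /from_slice[a Ka <-]; have [a0|a0] := leP 0 (dotv v a).
    by rewrite (le_trans _ a0)// oppr_le0 ltW.
  by rewrite lerNl; apply: leHm.
- by exists yn.
- rewrite (moment_rotate oQ Qv M0 mK KM) ?VE//; by rewrite -VE gt_eqF.
(* Pairing the shifted center with the unit vector [v] gives the sign condition on [c] plus the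
   shift. *)
case: Kcg => _; rewrite /= dotv_linear.
have vv : dotv v v = 1.
  have := congr1 (fun x => x ^+ 2) v1; rewrite /enorm expr1n => <-; rewrite sqr_sqrtr//.
  rewrite /dotv mxE; apply: sumr_ge0 => i _; rewrite [v^T _ _]mxE -expr2; exact: sqr_ge0.
by rewrite vv mulr1 /Lambda Aarea VE.
Qed.
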